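(* Let $d\ge 1$, $\alpha\in(0,2]$, $p\in(0,1)$ with $\alpha p>1$, and let $t\in\mathbb{R}_+=[0,\infty)$. Let $(S_n)_{n\ge 0}$ be the $d$-dimensional Shark Random Swim with memory parameter $p$ and stability parameter $\alpha$, written as $S_n=\sum_{i=1}^n |c_{i,n}|\,\xi_i$, and let $X_i=\lim_{n\to\infty} n^{-p}|c_{i,n}|$ (almost sure limit). Put $Z:=\sum_{i=1}^{\infty}X_i\xi_i$. Then $|Z|<\infty$ almost surely, and $$\frac{1}{n^p}S_{\lfloor nt\rfloor}\longrightarrow t^pZ\quad\text{in probability as } n\to\infty .$$
   Context: Let $\xi_1,\xi_2,\dots$ be i.i.d. $\mathbb{R}^d$-valued random variables that are standard isotropic strictly $\alpha$-stable: $\mathbb{E}[e^{i\langle\theta,\xi_1\rangle}]=e^{-\|\theta\|^\alpha}$ for all $\theta\in\mathbb{R}^d$, with $\|\cdot\|$ the Euclidean norm. The Shark Random Swim is defined by steps $Y_1=\xi_1$ and, for $n\ge2$: with probability $p$, an index $U_n$ is chosen uniformly in $\{1,\dots,n-1\}$ and $Y_n=Y_{U_n}$; with probability $1-p$, $Y_n=\xi_n$. All these random choices are independent of each other and of the $\xi_i$. Set $S_0=0$ and $S_n=\sum_{i=1}^nY_i$. Clusters: equivalently, build a random recursive tree (node $1$ is the root; node $n\ge2$ is attached to a uniformly chosen node among $1,\dots,n-1$) and delete each edge independently with probability $1-p$ (Bernoulli bond percolation). For $i\le n$, $c_{i,n}$ is the connected component (cluster) of the percolated tree on $\{1,\dots,n\}$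 whose smallest label is $i$, with $c_{i,n}=\emptyset$ if there is no such cluster, and $|c_{i,n}|$ is its number of nodes. Node $n$ carries the step $Y_n$: it copies the step of its parent if the edge to the parent is kept, and has step $\xi_n$ if that edge is deleted (the root has step $\xi_1$). Thus all nodes of $c_{i,n}$ carry the step $\xi_i$, the cluster sizes are independent of $(\xi_i)$, and $S_n=\sum_{i=1}^n|c_{i,n}|\xi_i$. For each $i\ge1$ the limit $X_i=\lim_{n\to\infty}n^{-p}|c_{i,n}|$ exists and is finite almost surely. *)

(* Defs.v *)
From HB Require Import structures.
From mathcomp Require Export all_boot all_order all_algebra.
From mathcomp Require Export complex.
From mathcomp Require Export all_classical all_reals all_analysis.

Set Implicit Arguments.
Unset Strict Implicit.
Unset Printing Implicit Defensive.

Export Order.TTheory GRing.Theory Num.Theory.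
Export numFieldNormedType.Exports.

#[export] Set Implicit Arguments.
#[export] Unset Strict Implicit.
#[export] Unset Printing Implicit Defensive.

#[global] Open Scope classical_set_scope.
#[global] Open Scope ring_scope.

Section Euclidean.
Context {R : realType} {d : nat}.

Definition inner (u v : 'rV[R]_d) : R := \sum_(j < d) u 0 j * v 0 j.

(* The library norm on 'rV[R]_d is the sup norm; it induces the same topology. *)
Definition euclid_norm (v : 'rV[R]_d) : R := Num.sqrt (inner v v).

Definition borel_rV : set (set 'rV[R]_d) := <<s (@open 'rV[R]_d) >>.

End Euclidean.

Section Probability.
Context {R : realType} {disp : measure_display} {T : measurableType disp}.
Variable P : probability T R.

Definition random_vector (d : nat) (X : T -> 'rV[R]_d) : Prop :=
  forall B, borel_rV B -> measurable (X @^-1` B).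

(* E[exp(i <theta, X>)], the expectation being taken on the real and on the
   imaginary part. *)
Definition char_fun (d : nat) (X : T -> 'rV[R]_d) (theta : 'rV[R]_d) : R[i] :=
  Complex (fine 'E_P[fun w => cos (inner theta (X w))])
          (fine 'E_P[fun w => sin (inner theta (X w))]).

Definition mutually_independent (I : eqType) (D : set I)
    (F : I -> set (set T)) : Prop :=
  forall (s : seq I) (A : I -> set T), uniq s ->
    (forall i, i \in s -> D i /\ F i (A i)) ->
    P (\big[setI/setT]_(i <- s) A i) = (\prod_(i <- s) P (A i))%E.

Definition cvg_in_probability (d : nat) (V : nat -> T -> 'rV[R]_d)
    (V' : T -> 'rV[R]_d) : Prop :=
  forall e : R, 0 < e ->
    P [set w | e < euclid_norm (V n w - V' w)] @[n --> \oo] --> 0%E.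

End Probability.

Section SharkRandomSwim.
Context {R : realType} {disp : measure_display} {T : measurableType disp}.
Context {d : nat}.

(* Labels start at 1, so xi 0 and Y 0 are irrelevant, as are U k and eps k for
   k < 2. The event [eps k] means that step k repeats an earlier step, i.e.
   that the edge from node k to its parent U k is kept by the percolation. *)

(* inl (inl i), inl (inr k) and inr k index xi_i, U_k and eps_k. *)
Definition srs_index : set (nat + nat + nat) :=
  fun k => match k with
    | inl (inl i) => (1 <= i)%N
    | inl (inr k) => (2 <= k)%N
    | inr k => (2 <= k)%N
    end.

Definition srs_sigma (xi : nat -> T -> 'rV[R]_d) (U : nat -> T -> nat)
    (eps : nat -> T -> bool) (k : nat + nat + nat) : set (set T) :=
  match k with
  | inl (inl i) => preimage_set_system setT (xi i) borel_rV
  | inl (inr k) => preimage_set_system setT (U k) measurable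
  | inr k => preimage_set_system setT (eps k) measurable
  end.

(* The characteristic function in [srs_xi_law] determines the law of xi i, so
   that the xi i are identically distributed. *)
Record shark_random_swim (P : probability T R) (alpha p : R)
    (xi : nat -> T -> 'rV[R]_d) (U : nat -> T -> nat)
    (eps : nat -> T -> bool) (Y : nat -> T -> 'rV[R]_d) : Prop := {
  srs_xi_rv : forall i, (1 <= i)%N -> random_vector (xi i);
  srs_xi_law : forall i, (1 <= i)%N -> forall theta : 'rV[R]_d,
    char_fun P (xi i) theta =
    Complex (expR (- (euclid_norm theta `^ alpha))) 0;
  srs_U_rv : forall k, (2 <= k)%N -> measurable_fun setT (U k);
  srs_U_range : forall k, (2 <= k)%N -> forall w, (1 <= U k w <= k.-1)%N;
  srs_U_law : forall k, (2 <= k)%N -> forall j, (1 <= j <= k.-1)%N ->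
    P [set w | U k w = j] = (k.-1%:R^-1)%:E;
  srs_eps_rv : forall k, (2 <= k)%N -> measurable_fun setT (eps k);
  srs_eps_law : forall k, (2 <= k)%N -> P [set w | eps k w] = p%:E;
  srs_indep : mutually_independent P srs_index (srs_sigma xi U eps);
  srs_Y1 : forall w, Y 1 w = xi 1 w;
  srs_Yk : forall k, (2 <= k)%N -> forall w,
    Y k w = if eps k w then Y (U k w) w else xi k w
}.

Definition swim (Y : nat -> T -> 'rV[R]_d) (n : nat) (w : T) : 'rV[R]_d :=
  \sum_(1 <= i < n.+1) Y i w.

End SharkRandomSwim.

Section Clusters.

(* The percolated tree on the nodes 1, ..., n of 'I_n.+1 (0 is isolated). *)
Definition perc_edge (U : nat -> nat) (eps : nat -> bool) (n : nat) :
    rel 'I_n.+1 :=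
  fun a b => [&& (2 <= a)%N, eps a & U a == b] ||
             [&& (2 <= b)%N, eps b & U b == a].

Definition cluster (U : nat -> nat) (eps : nat -> bool) (n i : nat) :
    {set 'I_n.+1} :=
  [set v : 'I_n.+1 | [exists r : 'I_n.+1,
    [&& (1 <= i)%N, r == i :> nat, connect (@perc_edge U eps n) r v &
        [forall u : 'I_n.+1,
           connect (@perc_edge U eps n) r u ==> (i <= u)%N]]]].

End Clusters.

Section Limit.
Context {R : realType} {disp : measure_display} {T : measurableType disp}.

Definition cluster_size (U : nat -> T -> nat) (eps : nat -> T -> bool)
    (n i : nat) (w : T) : nat :=
  #|cluster (U ^~ w) (eps ^~ w) n i|.

(* X_i and Z below are total: [limn] takes a constant default value at the
   points w where the limit does not exist. *)
Definition cluster_lim (p : R) (U : nat -> T -> nat) (eps : nat -> T -> bool)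
    (i : nat) (w : T) : R :=
  limn (fun n => n%:R `^ (- p) * (cluster_size U eps n i w)%:R : R).

Definition Zpartial (d : nat) (p : R) (xi : nat -> T -> 'rV[R]_d)
    (U : nat -> T -> nat) (eps : nat -> T -> bool) (w : T) (n : nat) :
    'rV[R]_d :=
  \sum_(1 <= i < n.+1) cluster_lim p U eps i w *: xi i w.

Definition Zlim (d : nat) (p : R) (xi : nat -> T -> 'rV[R]_d)
    (U : nat -> T -> nat) (eps : nat -> T -> bool) (w : T) : 'rV[R]_d :=
  limn (Zpartial p xi U eps w).

End Limit.

(* Main.v *)
Require Import Defs.
From mathcomp Require Import all_boot all_order all_algebra.
From mathcomp Require Import all_classical all_reals all_analysis.
From mathcomp Require Import ring lra zify.
From mathcomp Require Import measurable_realfun.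

Local Open Scope classical_set_scope.
Local Open Scope ring_scope.

(** Let [a_n] be the product of [1 + p/k] over [1 <= k < n]; it is asymptotic to
    [kappa n^p] for some constant [kappa]. Given the percolated tree on the
    first [n] nodes, node [n+1] joins the cluster of [i] with probability [p/n]
    times its size, so [M_i(n) = |c_(i,n)| / a_n] ([size_mg]) is a martingale
    from time [i] on, and it vanishes before. Its limit [M_i] satisfies
    [X_i = kappa M_i], and [S_n = a_n (M_1(n) xi_1 + ... + M_n(n) xi_n)] because
    a node carries the step of the root of its cluster ([swim_coord]). Hence it
    suffices to compare [M_1(m) xi_1 + ... + M_m(m) xi_m] with the infinite
    series with coefficients [M_i], one coordinate [x_i] of [xi_i] at a time.

    Two estimates carry the comparison. Put [th = (p - 1/alpha)/2]
    ([decay]), which is positive exactly because [alpha p > 1].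

    The first ([expect_mg_dist]) is a second moment bound. Martingale increments
    are orthogonal, and the increment at time [k] has second moment of order
    [i^(-p) k^(-(1+p))], so [M_i(n) - M_i(m)] has [L^2] norm at most a constant
    times [i^(th-p) (m+1)^(-th/2)]: part of the decay in [k] is traded for
    smallness in [i], uniformly in [n].

    The second ([integral_combo_le]) bounds a sum of [b_i x_i] in [L^1], when
    the weights [b_i] depend on the tree only and have [L^2] norm at most
    [B i^(th-p)]. For [alpha < 2] the steps have no second moment, so [x_i] is
    split at the level [i^(1/alpha)] into [sin (lam x_i) / lam], with
    [lam = i^(-1/alpha)], and a remainder. The moments of both parts come from
    the characteristic function alone, through
    [E (1 - cos (mu x)) <= mu^alpha]. The truncated steps are centred and
    independent of the tree, hence orthogonal, and their weighted sum is
    controlled in [L^2] by the sum of the [i^(-(1 + 2 th))]; the remainders are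
    controlled in [L^1] by the sum of the [i^(-(1 + th))]. Both sums are
    finite, and the bound is a constant times [B] for any number of terms.

    With [b_i = M_i(m) - M_i(n)] and [B] of order [(m+1)^(-th/2)], Fatou's lemma
    lets [n] tend to infinity and shows that [S_m / a_m] is within a constant
    times [(m+1)^(-th/2)] of the limiting series in [L^1]
    ([coord_limit_dist]). Markov's inequality at [m = floor (n t)] concludes,
    since [a_m / n^p] tends to [kappa t^p] ([cvg_scaled_growth]).

    Almost sure convergence, of each [M_i(n)] and of the limiting series, is
    obtained twice from the same chaining criterion of Rademacher and Menshov
    ([chaining_ae_cvg]): a sequence converges almost surely if the second
    moments of its increments over blocks are bounded by block sums of
    [C k^(-(1 + delta))]. *)

(** * Real powers and the growth of the mean cluster size *)
Section RealPowers.
Context {R : realType}.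
Implicit Types (x y e p s : R) (k m n i : nat).

(** The arithmetic-geometric inequality in the form that turns second moments
    into first moments with a free scale [e], without square roots of
    expectations. *)
Lemma norm_le_sqr y e : 0 < e -> `|y| <= 2^-1 * (e^-1 * y ^+ 2 + e).
Proof.
move=> e0; rewrite ler_pdivlMl// -(ler_pM2r e0).
rewrite (_ : (_ + _) * e = y ^+ 2 + e ^+ 2); last by field; rewrite gt_eqF.
have : 0 <= (`|y| - e) ^+ 2 by rewrite sqr_ge0.
by rewrite sqrrB real_normK ?num_real//; lra.
Qed.

(** By concavity of the power. It is derived from the convexity of the
    exponential: two tangents at [p ln x], weighted by [p] and [1 - p]. *)
Lemma powR_bernoulli x p : 0 < x -> 0 <= p <= 1 -> x `^ p <= 1 + p * (x - 1).
Proof.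
move=> x0 /andP[p0 p1].
have tangent (v w : R) : expR w * (1 + (v - w)) <= expR v.
  by rewrite -[X in _ <= expR X](subrK w) expRD [leRHS]mulrC ler_pM2l ?expR_gt0// expR_ge1Dx.
have := tangent (ln x) (p * ln x); have := tangent 0 (p * ln x).
rewrite lnK ?posrE// expR0 -ln_powR lnK ?posrE ?powR_gt0// ln_powR => t0 t1.
have := lerD (ler_wpM2l p0 t1) (ler_wpM2l (_ : 0 <= 1 - p) t0).
by rewrite subr_ge0 => /(_ p1); set y := x `^ p; set u := ln x; lra.
Qed.

Lemma invr_powR x s : 0 <= x -> (x `^ s)^-1 = x^-1 `^ s.
Proof. by move=> x0; rewrite -powRN -[in RHS]powR_inv1// -powRrM mulN1r. Qed.

Lemma ler_powRN x y s : 0 < x -> x <= y -> 0 <= s -> y `^ (- s) <= x `^ (- s).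
Proof.
move=> x0 xy s0; rewrite !powRN lef_pV2 ?posrE ?powR_gt0 ?(lt_le_trans x0)//.
by apply: ge0_ler_powR; rewrite ?nnegrE ?(ltW x0)// (le_trans (ltW x0)).
Qed.

Lemma natr_powR_gt0 n s : 0 < n.+1%:R `^ s :> R.
Proof. by rewrite powR_gt0. Qed.

(** The mean value theorem for the power [- s], which makes the Riemann series
    telescope. After dividing by [(k+1)^(- s)] it only uses
    [1 + y <= exp y] and [ln (1 + y) <= y]. *)
Lemma riemann_term_le s k : 0 < s -> (0 < k)%N ->
  k.+1%:R `^ (- (1 + s)) <= s^-1 * (k%:R `^ (- s) - k.+1%:R `^ (- s)).
Proof.
move=> s0 k0; have kR : 0 < k%:R :> R by rewrite ltr0n.
have k1R : 0 < k.+1%:R :> R by rewrite ltr0n.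
rewrite -ler_pdivrMl ?invr_gt0// invrK.
have -> : k%:R `^ (- s) = k.+1%:R `^ (- s) * (k%:R / k.+1%:R) `^ (- s).
  rewrite -powRM ?divr_ge0 ?ltW//; congr (_ `^ _).
  by rewrite mulrCA divff ?mulr1// gt_eqF.
have -> : k.+1%:R `^ (- (1 + s)) = k.+1%:R `^ (- s) * k.+1%:R^-1.
  rewrite opprD powRD; last by rewrite [_.+1%:R == _]gt_eqF// implybT.
  by rewrite powR_inv1 ?ltW// mulrC.
rewrite -[X in _ <= _ - X]mulr1 -mulrBr mulrCA ler_pM2l ?powR_gt0//.
set x := _ / _; have x0 : 0 < x by rewrite divr_gt0.
have <- : 1 - x = k.+1%:R^-1 :> R.
  by apply: (mulIf (lt0r_neq0 k1R)); rewrite mulVf ?gt_eqF// mulrBl divfK ?gt_eqF// mul1r -natrB// subSnn.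
rewrite lerBrDr /powR (gt_eqF x0); apply: le_trans (expR_ge1Dx _).
rewrite addrC lerD2l mulNr -mulrN ler_pM2l//.
by have := le_ln1Dx (_ : -1 < x - 1); rewrite ltrBDr addNr addrC subrK => /(_ x0); lra.
Qed.

Lemma riemann_tail_le s m n : 0 < s -> (0 < m)%N -> (m <= n)%N ->
  \sum_(m <= k < n) k.+1%:R `^ (- (1 + s)) <= s^-1 * m%:R `^ (- s).
Proof.
move=> s0 m0 mn; apply: (@le_trans _ _
    (\sum_(m <= k < n) s^-1 * (k%:R `^ (- s) - k.+1%:R `^ (- s)))).
  rewrite !big_nat; apply: ler_sum => k /andP[mk _].
  exact/riemann_term_le/(leq_trans m0).
rewrite -mulr_sumr ler_pM2l ?invr_gt0//.
rewrite (eq_bigr (fun k => - (k.+1%:R `^ (- s) - k%:R `^ (- s)))) => [|k _]; last by rewrite opprB.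
by rewrite sumrN telescope_sumr// opprB gerBl powR_ge0.
Qed.

Lemma riemann_sum_le s n : 0 < s ->
  \sum_(0 <= k < n) k.+1%:R `^ (- (1 + s)) <= 1 + s^-1.
Proof.
move=> s0; case: n => [|n]; first by rewrite big_geq// addr_ge0// invr_ge0 ltW.
rewrite big_ltn// powR1 lerD2l.
by apply: le_trans (riemann_tail_le s0 _ _) _; rewrite // powR1 mulr1.
Qed.

Lemma riemann_sum_le1 s n : 0 < s ->
  \sum_(1 <= i < n.+1) i%:R `^ (- (1 + s)) <= 1 + s^-1.
Proof. by move=> s0; rewrite big_add1; exact: riemann_sum_le. Qed.

End RealPowers.

Section GrowthFactor.
Context {R : realType}.
Variable p : R.
Hypothesis hp : 0 < p < 1.

(** In expectation a cluster grows by the factor [1 + p / n] when node [n + 1]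
    arrives. *)
Definition growth (n : nat) : R := \prod_(1 <= k < n) (1 + p / k%:R).

Lemma growthS n : (0 < n)%N -> growth n.+1 = (1 + p / n%:R) * growth n.
Proof. by move=> n0; rewrite /growth big_nat_recr//= mulrC. Qed.

Lemma growth1 : growth 1 = 1. Proof. by rewrite /growth big_geq. Qed.

Lemma growth_gt0 n : 0 < growth n.
Proof.
case/andP: hp => p0 p1; apply: prodr_gt0 => k _.
by rewrite ltr_pwDl// divr_ge0// ltW.
Qed.

Definition growth_ratio n := growth n / n%:R `^ p.

(** Bernoulli bounds the growth of the power: [(1 + 1/n)^p <= 1 + p/n]. *)
Lemma growth_ratio_nd n : (0 < n)%N -> growth_ratio n <= growth_ratio n.+1.
Proof.
case/andP: hp => p0 p1 n0; rewrite /growth_ratio growthS//.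
have nR : 0 < n%:R :> R by rewrite ltr0n.
have step : n.+1%:R `^ p <= (1 + p / n%:R) * n%:R `^ p :> R.
  rewrite -ler_pdivrMr ?powR_gt0//.
  have -> : n.+1%:R `^ p / n%:R `^ p = (n.+1%:R / n%:R) `^ p :> R.
    by rewrite powRM// ?invr_ge0 ?(ltW nR)// invr_powR ?(ltW nR).
  apply: le_trans (powR_bernoulli _ _) _; rewrite ?divr_gt0 ?ltr0n ?(ltW p0) ?(ltW p1)//.
  by rewrite lerD2l -natr1 mulrDl divff ?gt_eqF// addrAC subrr add0r mul1r.
rewrite ler_pdivlMr ?powR_gt0// mulrAC ler_pdivrMr ?powR_gt0//.
by rewrite mulrC mulrAC ler_pM2r ?growth_gt0.
Qed.

Lemma growth_ge n : (0 < n)%N -> n%:R `^ p <= growth n.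
Proof.
move=> n0; rewrite -[leLHS]mul1r -ler_pdivlMr ?powR_gt0 ?ltr0n// -/(growth_ratio n).
elim: n n0 => // -[|n] IH _; first by rewrite /growth_ratio growth1 powR1 divr1.
exact: le_trans (IH _) (growth_ratio_nd _).
Qed.

(** Shifting the index by [p] reverses the comparison: by Bernoulli's inequality
    for the inverses, [1 + p/k <= ((k + p) / (k - 1 + p))^p], and the product of
    the right-hand sides telescopes. *)
Lemma growth_le n : (0 < n)%N -> growth n <= (n%:R / p) `^ p.
Proof.
case/andP: hp => p0 p1.
have aux k : growth k.+1 <= ((k%:R + p) / p) `^ p.
  elim: k => [|k IH]; first by rewrite growth1 add0r divff ?gt_eqF// powR1.
  rewrite growthS//; set y := k.+1%:R : R.
  have y1 : 1 <= y by rewrite ler1n.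
  have yp0 : 0 < y + p by lra.
  have kp0 : 0 < k%:R + p by rewrite ltr_wpDl.
  have py0 : 0 < 1 + p / y by rewrite ltr_pwDl// divr_ge0 ?(ltW p0)//; lra.
  have step : 1 + p / y <= ((y + p) / (k%:R + p)) `^ p.
    rewrite -[leRHS]invrK -[leLHS]invrK lef_pV2 ?posrE ?invr_gt0 ?powR_gt0 ?divr_gt0//.
    rewrite invr_powR ?divr_ge0 ?(ltW yp0) ?(ltW kp0)// invf_div.
    apply: le_trans (powR_bernoulli _ _) _; rewrite ?divr_gt0 ?ltr_wpDl ?(ltW p0) ?(ltW p1)//.
    have -> : k%:R = y - 1 by rewrite /y -natr1 addrK.
    rewrite le_eqVlt; apply/orP; left; apply/eqP; field.
    by rewrite !gt_eqF//; lra.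
  apply: le_trans (ler_pM _ _ step IH) _; rewrite ?(ltW py0) ?(ltW (growth_gt0 _))//.
  rewrite -powRM ?divr_ge0 ?(ltW yp0) ?(ltW p0) ?(ltW kp0)//.
  by rewrite mulrA divfK ?gt_eqF.
case: n => // n _; apply: le_trans (aux n) _.
apply: ge0_ler_powR; rewrite ?nnegrE ?divr_ge0 ?addr_ge0 ?(ltW p0)//.
by rewrite ler_pM2r ?invr_gt0// -natr1 lerD2l ltW.
Qed.

Lemma is_cvg_growth_ratio : cvgn growth_ratio.
Proof.
case/andP: hp => p0 p1.
have nd : {homo (fun n => growth_ratio n.+1) : n m / (n <= m)%N >-> n <= m}.
  by apply/nondecreasing_seqP => n; exact: growth_ratio_nd.
have /cvg_ex[l lP] : cvgn (fun n => growth_ratio n.+1).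
  apply: nondecreasing_is_cvgn => //; exists (p^-1 `^ p) => _ [n _ <-].
  rewrite /growth_ratio ler_pdivrMr ?powR_gt0// -powRM ?invr_ge0 ?(ltW p0)// mulrC.
  exact: growth_le.
by apply/cvg_ex; exists l; rewrite -cvg_shiftS.
Qed.

End GrowthFactor.

(** * Smooth truncation by the sine *)
Section SineTruncation.
Context {R : realType}.
Implicit Types (x lam mu : R) (k K : nat).

(** A smooth substitute for the truncation of [x] at level [1 / lam]. It is
    bounded by [1 / lam] and odd, and cosines, whose expectations are values of
    the characteristic function, express its square and bound its distance to
    [x]. *)
Definition sin_trunc lam x : R := sin (lam * x) / lam.

Lemma sin_trunc_sqr lam x : 0 < lam ->
  sin_trunc lam x ^+ 2 = (1 - cos (2 * lam * x)) / (2 * lam ^+ 2).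
Proof.
move=> lam0; rewrite /sin_trunc expr_div_n -mulrA mulr_natl cos_mulr2n cos2sin2.
by field; rewrite gt_eqF.
Qed.

(** Doubling formula: [sin (2 y) = 2 sin y cos y] turns the difference into a
    sine times [(1 - cos (mu x)) / mu], where [mu = lam / 2]. *)
Lemma sin_trunc_halve lam x : 0 < lam ->
  `|sin_trunc (lam / 2) x - sin_trunc lam x| <= (1 - cos (lam / 2 * x)) / (lam / 2).
Proof.
move=> lam0; set mu := lam / 2.
have mu0 : 0 < mu by rewrite divr_gt0.
have -> : lam = 2 * mu by rewrite /mu mulrC divfK.
rewrite /sin_trunc -[in sin (2 * _ * _)]mulrA mulr_natl sin_mulr2n.
have -> : sin (mu * x) / mu - (cos (mu * x) * sin (mu * x)) *+ 2 / (2 * mu)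
   = sin (mu * x) * ((1 - cos (mu * x)) / mu) by field; rewrite gt_eqF.
have c0 : 0 <= (1 - cos (mu * x)) / mu.
  by rewrite divr_ge0 ?(ltW mu0)// subr_ge0 cos_le1.
by rewrite normrM (ger0_norm c0) ler_piMl// sin_max.
Qed.

(** Halving the frequency [K] times approaches [x] itself, and each halving costs
    one term of the form [1 - cos], whose expectation is explicit. *)
Lemma sin_trunc_dist lam x K : 0 < lam ->
  `|sin_trunc (lam / 2 ^+ K) x - sin_trunc lam x| <=
  \sum_(0 <= k < K) (1 - cos (lam / 2 ^+ k.+1 * x)) / (lam / 2 ^+ k.+1).
Proof.
move=> lam0; elim: K => [|K IH]; first by rewrite expr0 divr1 subrr normr0 big_geq.
rewrite big_nat_recr//= addrC.
apply: le_trans (ler_distD (sin_trunc (lam / 2 ^+ K) x) _ _) _.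
apply: lerD => //; have h : lam / 2 ^+ K.+1 = lam / 2 ^+ K / 2.
  by rewrite exprSr invfM mulrA.
by rewrite h; apply: sin_trunc_halve; rewrite divr_gt0// exprn_gt0.
Qed.

(** The derivative of the sine at zero. *)
Lemma sin_trunc_cvg lam x : 0 < lam ->
  sin_trunc (lam / 2 ^+ K) x @[K --> \oo] --> x.
Proof.
move=> lam0; have [->|x0] := eqVneq x 0.
  by under eq_fun do rewrite /sin_trunc mulr0 sin0 mul0r; exact: cvg_cst.
pose u K : R := lam / 2 ^+ K * x.
have u0 K : u K != 0.
  by rewrite /u !mulf_neq0// ?gt_eqF// invr_gt0 exprn_gt0.
have ucvg : u K @[K --> \oo] --> (0 : R).
  rewrite -[0](mul0r x); apply: cvgMl.
  rewrite (_ : (fun K => _) = geometric lam (2^-1)).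
    by apply: cvg_geometric; rewrite ger0_norm ?invr_ge0// invf_lt1// ltr1n.
  by apply/funext => K; rewrite /geometric/= exprVn.
have dsin : h^-1 *: (sin (h *: 1 + 0) - sin 0) @[h --> (0 : R)^'] --> (1 : R^o).
  rewrite [X in _ --> X](_ : 1 = 'D_1 sin (0 : R)); last by rewrite derive_val cos0.
  exact: (@derivable_sin R 0).
have /cvgr_dnbhsP/(_ u (conj u0 ucvg)) su := dsin.
rewrite (_ : (fun K => _) = (fun K => x * ((u K)^-1 *: (sin (u K *: 1 + 0) - sin 0)))).
  by rewrite -[X in _ --> X]mulr1; apply: cvgMr.
apply/funext => K; rewrite sin0 subr0 addr0 /sin_trunc /u /GRing.scale/= mulr1.
set mu := lam / _; set y := sin _.
have mu0 : mu != 0 by rewrite mulf_neq0 ?gt_eqF// invr_gt0 exprn_gt0.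
by clearbody y mu; field; rewrite x0 mu0.
Qed.

End SineTruncation.

(** * Convergence by dyadic chaining *)
Section DyadicChaining.
Context {R : realType}.
Implicit Types (S G : nat -> R).

(** The squared increments of [S] over the left halves met when [a, a + 2^k] is
    repeatedly halved, and over the final unit blocks: these are the jumps
    from which every path from [a] into the block can be composed. *)
Fixpoint dyadic_energy S k a : R :=
  if k is k'.+1 then
    (S (a + 2 ^ k')%N - S a) ^+ 2
      + (dyadic_energy S k' a + dyadic_energy S k' (a + 2 ^ k')%N)
  else (S a.+1 - S a) ^+ 2.

Lemma dyadic_energy_ge0 S k a : 0 <= dyadic_energy S k a.
Proof.
by elim: k a => [|k IH] a /=; rewrite ?sqr_ge0// !addr_ge0// sqr_ge0.
Qed.

(** The point [n] is reached from [a] by dyadic jumps of distinct lengths, so at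
    most [k + 1] of them, and the Cauchy-Schwarz inequality applies. This
    controls the maximum over the whole block by one random variable. *)
Lemma dyadic_energy_bound S k a n : (a <= n <= a + 2 ^ k)%N ->
  (S n - S a) ^+ 2 <= k.+1%:R * dyadic_energy S k a.
Proof.
elim: k a n => [|k IH] a n /andP[an na].
  rewrite mul1r /=; move: na; rewrite expn0 addn1 leq_eqVlt ltnS => /predU1P[->//|na].
  have -> : n = a by apply/eqP; rewrite eqn_leq na.
  by rewrite subrr expr0n/= sqr_ge0.
rewrite /=; set x := S (a + 2 ^ k)%N - S a.
set D0 := dyadic_energy S k a; set D1 := dyadic_energy S k (a + 2 ^ k)%N.
have D00 : 0 <= D0 by exact: dyadic_energy_ge0.
have D10 : 0 <= D1 by exact: dyadic_energy_ge0.
have x0 : 0 <= x ^+ 2 by rewrite sqr_ge0.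
have k0 : (0 : R) < k.+1%:R by rewrite ltr0n.
have [nk|nk] := leqP n (a + 2 ^ k)%N.
  apply: le_trans (IH a n _) _; first by rewrite an.
  rewrite -/D0 -[in leRHS]natr1 mulrDl mul1r -[leLHS]addr0.
  by rewrite lerD// ?ler_wpM2l ?addr_ge0 ?(ltW k0)// addrCA lerDl addr_ge0.
have := IH (a + 2 ^ k)%N n; rewrite (ltnW nk)/= -addnA addnn -mul2n -expnS na.
move=> /(_ isT); set y := S n - _; rewrite -/D1 => yD.
have -> : S n - S a = x + y by rewrite /x /y; ring.
rewrite -natr1; set c := k.+1%:R in k0 yD *.
(* Cauchy-Schwarz for one jump [x] and [c = k + 1] further jumps *)
apply: (@le_trans _ _ ((c + 1) * (x ^+ 2 + y ^+ 2 / c))).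
  rewrite -subr_ge0 (_ : _ - _ = (c * x - y) ^+ 2 / c); last by field; rewrite gt_eqF.
  by rewrite divr_ge0 ?sqr_ge0// ltW.
rewrite ler_wpM2l ?addr_ge0 ?(ltW k0)// lerD2l.
rewrite ler_pdivrMr// (le_trans yD)// mulrC ler_wpM2r ?(ltW k0)// lerDr//.
Qed.

(** Convergence along the powers of two and oscillations between them that tend to
    zero: the summable bound [G] gives both. *)
Lemma dyadic_cvg S G :
    (forall k n, (2 ^ k <= n <= 2 ^ k.+1)%N -> `|S n - S (2 ^ k)%N| <= G k) ->
  cvgn (series G) -> cvgn S.
Proof.
move=> SG cG.
have G0 k : 0 <= G k.
  apply: le_trans (normr_ge0 _) (SG k (2 ^ k)%N _); by rewrite leqnn leq_exp2l//=.
have cS : cvgn (fun k => S (2 ^ k)%N).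
  have tel k : S (2 ^ k)%N = S 1 + series (fun j => S (2 ^ j.+1)%N - S (2 ^ j)%N) k.
    by rewrite /series/= telescope_sumr// expn0 addrC subrK.
  rewrite (funext tel); apply: is_cvgD; first exact: is_cvg_cst.
  apply: normed_cvg; apply: series_le_cvg cG => [k|k|k] /=; rewrite ?normr_ge0//.
  by apply: SG; rewrite leqnn andbT leq_exp2l//=.
have G0' := cvg_series_cvg_0 cG.
case/cvg_ex: cS => l Sl; apply/cvg_ex; exists l.
apply/cvgrPdist_lt => e e0; have e20 : 0 < e / 2 by rewrite divr_gt0.
move/cvgrPdist_lt/(_ _ e20): Sl => [N1 _ H1].
move/cvgrPdist_lt/(_ _ e20): G0' => [N2 _ H2].
exists (2 ^ (maxn N1 N2))%N => //= n /= nN.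
have n0 : (0 < n)%N by apply: leq_trans nN; rewrite expn_gt0.
pose k := trunc_log 2 n.
have Nk : (maxn N1 N2 <= k)%N by apply: trunc_log_max.
have kn : (2 ^ k <= n <= 2 ^ k.+1)%N.
  by rewrite trunc_logP//= ltnW// trunc_log_ltn.
rewrite -(subrK (S (2 ^ k)%N) l) -addrA (le_lt_trans (ler_normD _ _))//.
rewrite [ltRHS](Num.Theory.splitr e) ltrD//; first by apply: H1 => /=; exact: leq_trans (leq_maxl _ _) Nk.
rewrite distrC; apply: le_lt_trans (SG _ _ kn) _.
have := H2 k (leq_trans (leq_maxr _ _) Nk).
by rewrite sub0r normrN ger0_norm.
Qed.

Lemma exprn_bernoulli (x : R) n : 0 <= x -> 1 + n%:R * x <= (1 + x) ^+ n.
Proof.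
move=> x0; elim: n => [|n IH]; first by rewrite mul0r addr0 expr0.
rewrite exprS -natr1; apply: le_trans (ler_wpM2l _ IH); last by rewrite addr_ge0.
rewrite -subr_ge0 (_ : _ - _ = n%:R * (x * x)); last by ring.
by rewrite mulr_ge0// mulr_ge0.
Qed.

(** Bernoulli bounds [k + 1] by a multiple of [r^-(k+1)], so that its square is
    absorbed by half of the geometric decay. The fourth power keeps the exponents integral. *)
Lemma cvg_series_sqr_geometric (r : R) : 0 < r < 1 ->
  cvgn (series (fun k => k.+1%:R ^+ 2 * (r ^+ 4) ^+ k)).
Proof.
case/andP=> r0 r1; pose eta := r^-1 - 1.
have eta0 : 0 < eta by rewrite subr_gt0 invf_gt1.
have kr k : k.+1%:R * eta <= r ^- k.+1.
  rewrite -exprVn; have := exprn_bernoulli k.+1 (ltW eta0).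
  by rewrite [1 + eta]addrC subrK; apply: le_trans; rewrite lerDr.
apply: (@series_le_cvg _ _ (geometric ((eta * r) ^- 2) (r ^+ 2))) => [k|k|k|].
- by rewrite mulr_ge0 ?sqr_ge0// exprn_ge0// exprn_ge0// ltW.
- by rewrite geometric_ge0 ?invr_ge0 ?sqr_ge0// exprn_ge0// ?mulr_ge0 ?ltW.
- rewrite /geometric/=.
  have -> : (eta * r) ^- 2 * (r ^+ 2) ^+ k = (r ^- k.+1 / eta) ^+ 2 * (r ^+ 4) ^+ k.
    rewrite [r ^+ k.+1]exprS ![(r ^+ _) ^+ k]exprAC; set u := r ^+ k.
    have u0 : u != 0 by rewrite expf_neq0// gt_eqF.
    by field; rewrite u0 !gt_eqF//.
  apply: ler_wpM2r; first by rewrite exprn_ge0// exprn_ge0// ltW.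
  have rk0 : 0 <= r ^- k.+1 / eta by rewrite divr_ge0 ?invr_ge0 ?exprn_ge0 ?ltW.
  by rewrite ler_sqr ?nnegrE// ler_pdivlMr.
apply: is_cvg_geometric_series; rewrite ger0_norm ?sqr_ge0//.
by rewrite exprn_ilt1// ltW.
Qed.

End DyadicChaining.

(** * Expectations of bounded random variables *)
Section BoundedExpectation.
Context {R : realType} {d : measure_display} {T : measurableType d}.
Variable P : probability T R.
Implicit Types (f g : T -> R).

(** A class of random variables stable under sums and products, on which the
    real-valued integral is linear without integrability side conditions. *)
Definition bounded_rv f := measurable_fun setT f /\ exists K : R, forall w, `|f w| <= K.

Lemma bounded_rv_measurable f : bounded_rv f -> measurable_fun setT f.
Proof. by case. Qed.

Lemma bounded_rv_cst (c : R) : bounded_rv (fun=> c).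
Proof. by split; [exact: measurable_cst|exists `|c|]. Qed.

Lemma bounded_rvD f g : bounded_rv f -> bounded_rv g -> bounded_rv (fun w => f w + g w).
Proof.
move=> [mf [K fK]] [mg [L gL]]; split; first exact: measurable_funD.
by exists (K + L) => w; rewrite (le_trans (ler_normD _ _))// lerD.
Qed.

Lemma bounded_rvN f : bounded_rv f -> bounded_rv (fun w => - f w).
Proof.
move=> [mf [K fK]]; split; first exact: measurable_funN.
by exists K => w; rewrite normrN.
Qed.

Lemma bounded_rvB f g : bounded_rv f -> bounded_rv g -> bounded_rv (fun w => f w - g w).
Proof. by move=> bf bg; apply: bounded_rvD => //; exact: bounded_rvN. Qed.

Lemma bounded_rvM f g : bounded_rv f -> bounded_rv g -> bounded_rv (fun w => f w * g w).
Proof.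
move=> [mf [K fK]] [mg [L gL]]; split; first exact: measurable_funM.
by exists (K * L) => w; rewrite normrM ler_pM.
Qed.

Lemma bounded_rvX f n : bounded_rv f -> bounded_rv (fun w => f w ^+ n).
Proof.
move=> bf; elim: n => [|n IH]; first exact: bounded_rv_cst.
by under eq_fun do rewrite exprS; exact: bounded_rvM.
Qed.

Lemma bounded_rv_norm f : bounded_rv f -> bounded_rv (fun w => `|f w|).
Proof.
move=> [mf [K fK]]; split; first exact: measurableT_comp.
by exists K => w; rewrite normr_id.
Qed.

Lemma bounded_rv_sum (I : Type) (s : seq I) (Q : pred I) (F : I -> T -> R) :
  (forall i, Q i -> bounded_rv (F i)) -> bounded_rv (fun w => \sum_(i <- s | Q i) F i w).
Proof.
move=> bF; elim: s => [|i s IH].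
  by under eq_fun do rewrite big_nil; exact: bounded_rv_cst.
under eq_fun do rewrite big_cons.
case: (boolP (Q i)) => // Qi; apply: bounded_rvD => //; exact: bF.
Qed.

Lemma measurable_fun_natb (b : T -> bool) : measurable_fun setT b ->
  measurable_fun setT (fun w => (b w)%:R : R).
Proof.
move=> mb; rewrite (_ : (fun w => _) = (fun w => if b w then 1 else 0 : R)).
  by apply: measurable_fun_ifT => //; exact: measurable_cst.
by apply/funext => w; case: (b w).
Qed.

Lemma bounded_rv_nat (b : T -> bool) : measurable_fun setT b ->
  bounded_rv (fun w => (b w)%:R).
Proof.
move=> mb; split; first exact: measurable_fun_natb.
by exists 1 => w; case: (b w); rewrite ?normr0 ?normr1.
Qed.

Lemma bounded_rv_integrable f : bounded_rv f -> P.-integrable setT (EFin \o f).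
Proof.
move=> [mf [K fK]]; apply: measurable_bounded_integrable => //.
  by rewrite ltey_eq fin_num_measure.
exists K; split; rewrite ?num_real// => M KM w _ /=; exact: le_trans (fK w) (ltW KM).
Qed.

Lemma bounded_rvE f : bounded_rv f -> (\int[P]_w (f w)%:E)%E = (\int[P]_w f w)%:E.
Proof.
move=> bf; rewrite /Rintegral fineK//; apply: integrable_fin_num => //.
exact: bounded_rv_integrable.
Qed.

Lemma expectD f g : bounded_rv f -> bounded_rv g ->
  \int[P]_w (f w + g w) = \int[P]_w f w + \int[P]_w g w.
Proof. by move=> bf bg; rewrite RintegralD//; exact: bounded_rv_integrable. Qed.

Lemma expectB f g : bounded_rv f -> bounded_rv g ->
  \int[P]_w (f w - g w) = \int[P]_w f w - \int[P]_w g w.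
Proof. by move=> bf bg; rewrite RintegralB//; exact: bounded_rv_integrable. Qed.

Lemma expectZ c f : bounded_rv f -> \int[P]_w (c * f w) = c * \int[P]_w f w.
Proof. by move=> bf; rewrite RintegralZl//; exact: bounded_rv_integrable. Qed.

Lemma expect_cst c : \int[P]_w c = c.
Proof. by rewrite Rintegral_cst//= probability_setT mulr1. Qed.

Lemma expect_sum (I : Type) (s : seq I) (Q : pred I) (F : I -> T -> R) :
  (forall i, Q i -> bounded_rv (F i)) ->
  \int[P]_w (\sum_(i <- s | Q i) F i w) = \sum_(i <- s | Q i) \int[P]_w F i w.
Proof.
move=> bF; elim: s => [|i s IH].
  by under eq_Rintegral do rewrite big_nil; rewrite big_nil expect_cst.
under eq_Rintegral do rewrite big_cons; rewrite big_cons.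
case: (boolP (Q i)) => // Qi; rewrite expectD ?IH//; first exact: bF.
exact: bounded_rv_sum.
Qed.

Lemma le_expect f g : bounded_rv f -> bounded_rv g -> (forall w, f w <= g w) ->
  \int[P]_w f w <= \int[P]_w g w.
Proof. by move=> bf bg fg; apply: le_Rintegral => //; exact: bounded_rv_integrable. Qed.

Lemma expect_ge0 f : (forall w, 0 <= f w) -> 0 <= \int[P]_w f w.
Proof. by move=> f0; exact: Rintegral_ge0. Qed.

Lemma expect_bool (b : T -> bool) :
  measurable_fun setT b -> \int[P]_w (b w)%:R = fine (P [set w | b w]).
Proof.
move=> mb; rewrite /Rintegral; congr fine.
have mB : measurable [set w | b w].
  by have := mb measurableT [set true]; rewrite setTI; apply.
rewrite -[X in P X]setIT -[RHS]integral_indic//; apply: eq_integral => w _.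
by rewrite indicE; congr ((nat_of_bool _)%:R%:E); apply/idP/idP; rewrite inE.
Qed.

Lemma le_integral_bounded f C : bounded_rv f -> \int[P]_w f w <= C ->
  (\int[P]_w (f w)%:E <= C%:E)%E.
Proof. by move=> bf fC; rewrite bounded_rvE// lee_fin. Qed.

End BoundedExpectation.

(** * Almost sure convergence *)
Section AlmostSure.
Context {R : realType} {d : measure_display} {T : measurableType d}.
Variable P : probability T R.
Implicit Types (f g : T -> R).

(** Fatou's lemma for a uniform bound along an almost surely convergent
    sequence; it replaces dominated convergence throughout. *)
Lemma fatou_le (f_ : nat -> T -> R) f C :
    (forall n, measurable_fun setT (f_ n)) -> (forall n w, 0 <= f_ n w) ->
    measurable_fun setT f -> (forall w, 0 <= f w) ->
    {ae P, forall w, f_ n w @[n --> \oo] --> f w} ->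
    (forall n, \int[P]_w (f_ n w)%:E <= C%:E)%E ->
  (\int[P]_w (f w)%:E <= C%:E)%E.
Proof.
move=> mf_ f_0 mf f0 f_f f_C.
have mE n : measurable_fun setT (fun w => (f_ n w)%:E) by exact/measurable_EFinP.
have f_E0 n w : setT w -> (0 <= (f_ n w)%:E)%E by rewrite lee_fin.
have mliminf : measurable_fun setT (fun w => limn_einf (fun n => (f_ n w)%:E)).
  rewrite (_ : (fun w => _) = (fun w => - limn_esup (fun n => - (f_ n w)%:E))%E).
    apply: measurableT_comp => //; apply: measurable_fun_limn_esup => n.
    exact: measurableT_comp.
  apply/funext => w; rewrite -limn_einfN; congr limn_einf.
  by apply/funext => n; rewrite /comp oppeK.
have -> : (\int[P]_w (f w)%:E = \int[P]_w limn_einf (fun n => (f_ n w)%:E))%E.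
  apply: ae_eq_integral => //; first exact/measurable_EFinP.
  apply: filterS f_f => w fw _; apply/esym.
  have fE : (f_ n w)%:E @[n --> \oo] --> (f w)%:E by apply: cvg_EFin => //; exact: nearW.
  by rewrite (cvg_limn_einf_sup fE).
apply: le_trans (fatou P measurableT mE f_E0) _.
rewrite limn_einf_lim; apply: lime_le; first exact: is_cvg_einfs.
apply: nearW => n; apply: le_trans (f_C n).
by apply: ereal_inf_lbound; exists n => /=.
Qed.

(** The sum of the series has a finite integral, hence is almost surely
    finite. *)
Lemma ae_cvg_series (G : nat -> T -> R) (g : nat -> R) :
    (forall k, measurable_fun setT (G k)) -> (forall k w, 0 <= G k w) ->
    (forall k, \int[P]_w (G k w)%:E <= (g k)%:E)%E -> cvgn (series g) ->
  {ae P, forall w, cvgn (series (G ^~ w))}.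
Proof.
move=> mG G0 Gg cg.
have g0 k : 0 <= g k.
  by rewrite -lee_fin; apply: le_trans (Gg k); apply: integral_ge0 => w _; rewrite lee_fin.
have mGE k : measurable_fun setT (fun w => (G k w)%:E) by exact/measurable_EFinP.
have GE0 k w : setT w -> (0 <= (G k w)%:E)%E by rewrite lee_fin.
pose tot w : \bar R := (\sum_(k <oo) (G k w)%:E)%E.
have tot_int : P.-integrable setT tot.
  apply/integrableP; split.
    by apply: (@ge0_emeasurable_sum _ _ _ setT (fun k w => (G k w)%:E) xpredT) => // k w _ _;
      rewrite lee_fin.
  have tot0 w : (0 <= tot w)%E by apply: nneseries_ge0 => k _ _; exact: GE0.
  rewrite (eq_integral tot) => [|w _]; last by rewrite gee0_abs.
  rewrite integral_nneseries//.
  apply: (@le_lt_trans _ _ (limn (series g))%:E); last exact: ltry.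
  rewrite -EFin_lim//; apply: lee_lim.
  - apply: is_cvg_nneseries => k _ _; apply: integral_ge0 => w _.
    by rewrite lee_fin.
  - by case/cvg_ex: cg => l gl; apply/cvg_ex; exists l%:E; apply: cvg_EFin => //; exact: nearW.
  - by apply: nearW => n; rewrite /series/= -sumEFin; apply: lee_sum.
have := integrable_ae measurableT tot_int; apply: filterS => w /(_ I) wfin.
apply: nondecreasing_is_cvgn.
  by apply: nondecreasing_series => k _ _; exact: G0.
exists (fine (tot w)) => _ [n _ <-]; rewrite -lee_fin fineK//.
rewrite /series/= -sumEFin; apply: nneseries_lim_ge => k _ _.
by rewrite lee_fin.
Qed.

Lemma measurable_dyadic_energy (S : nat -> T -> R) k a :
  (forall n, measurable_fun setT (S n)) ->
  measurable_fun setT (fun w => dyadic_energy (S ^~ w) k a).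
Proof.
move=> mS; elim: k a => [|k IH] a /=.
  by apply: measurable_funX; exact: measurable_funB.
apply: measurable_funD; last exact: measurable_funD.
by apply: measurable_funX; exact: measurable_funB.
Qed.

(** At each of the [k + 1] dyadic scales the jumps are over disjoint parts of the
    block, so they contribute at most the sum of [v] over the block. *)
Lemma le_dyadic_energy (S : nat -> T -> R) (v : nat -> R) k a :
    (forall n, measurable_fun setT (S n)) ->
    (forall m n, (m <= n)%N ->
      \int[P]_w ((S n w - S m w) ^+ 2)%:E <= (\sum_(m <= i < n) v i)%:E)%E ->
  (\int[P]_w (dyadic_energy (S ^~ w) k a)%:E <=
    (k.+1%:R * \sum_(a <= i < a + 2 ^ k) v i)%:E)%E.
Proof.
move=> mS Sv.
have mD k1 b := measurable_dyadic_energy k1 b mS.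
elim: k a => [|k IH] a.
  by rewrite mul1r expn0 addn1; exact: Sv.
rewrite /=; under eq_integral do rewrite !EFinD.
rewrite ge0_integralD//; last 4 first.
- by move=> w _; rewrite lee_fin sqr_ge0.
- by apply/measurable_EFinP/measurable_funX; exact: measurable_funB.
- by move=> w _; rewrite adde_ge0// lee_fin dyadic_energy_ge0.
- by apply: emeasurable_funD; exact/measurable_EFinP.
rewrite ge0_integralD//; last 4 first.
- by move=> w _; rewrite lee_fin dyadic_energy_ge0.
- exact/measurable_EFinP.
- by move=> w _; rewrite lee_fin dyadic_energy_ge0.
- exact/measurable_EFinP.
have aa : (a <= a + 2 ^ k)%N by rewrite leq_addr.
have v0 : 0 <= \sum_(a + 2 ^ k <= i < a + 2 ^ k.+1) v i.
  rewrite -lee_fin; apply: le_trans (Sv (a + 2 ^ k)%N (a + 2 ^ k.+1)%N _).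
    by apply: integral_ge0 => w _; rewrite lee_fin sqr_ge0.
  by rewrite leq_add2l leq_exp2l.
have IH2 := IH (a + 2 ^ k)%N; rewrite -addnA addnn -mul2n -expnS in IH2.
apply: le_trans (leeD (Sv _ _ aa) (leeD (IH a) IH2)) _.
rewrite -!EFinD lee_fin (@big_cat_nat _ _ _ (a + 2 ^ k)%N a (a + 2 ^ k.+1)%N)//=; last first.
  by rewrite leq_add2l leq_exp2l.
rewrite -[k.+2%:R]natr1; set x := \sum_(a <= i < _) _; set y := \sum_(_ <= i < _) _ in v0 *.
by move: v0; rewrite -/y; lra.
Qed.

(** A criterion of Rademacher-Menshov type. The energy of the dyadic block
    [2^k, 2^(k+1)] has expectation of order [(k + 1) 2^(- delta k)], hence is
    summable even after division by a small power of [2^-k]; the oscillations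
    over the blocks are then summable almost surely. *)
Lemma chaining_ae_cvg (S : nat -> T -> R) C delta :
    0 < delta -> 0 <= C -> (forall n, measurable_fun setT (S n)) ->
    (forall m n, (m <= n)%N -> \int[P]_w ((S n w - S m w) ^+ 2)%:E <=
      (\sum_(m <= i < n) C * i.+1%:R `^ (- (1 + delta)))%:E)%E ->
  {ae P, forall w, cvgn (S ^~ w)}.
Proof.
move=> d0 C0 mS Sv.
(* with [q = r^4], the factor [2^(- delta)] is [q^2]: one [q] is spent on the
   scale [q^k] of [norm_le_sqr], the other one is summed *)
pose r : R := 2 `^ (- (delta / 8)).
have r0 : 0 < r by rewrite powR_gt0.
have r1 : r < 1.
  by rewrite /r /powR gt_eqF// expR_lt1 mulNr oppr_lt0 mulr_gt0 ?ln_gt0 ?ltr1n ?divr_gt0.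
pose q := r ^+ 4; have q0 : 0 < q by rewrite exprn_gt0.
pose D k w := dyadic_energy (S ^~ w) k (2 ^ k).
pose G k w := 2^-1 * (k.+1%:R / q ^+ k * D k w + q ^+ k).
have D0 k w : 0 <= D k w by exact: dyadic_energy_ge0.
have qk0 k : 0 < q ^+ k by rewrite exprn_gt0.
have G0 k w : 0 <= G k w.
  by rewrite mulr_ge0// addr_ge0 ?(ltW (qk0 _))// mulr_ge0// divr_ge0// (ltW (qk0 _)).
have mD k : measurable_fun setT (D k).
  exact: measurable_dyadic_energy.
have mG k : measurable_fun setT (G k).
  by rewrite /G; apply: measurable_funM => //; apply: measurable_funD => //; exact: measurable_funM.
have block k : \sum_(2 ^ k <= i < 2 ^ k + 2 ^ k) C * i.+1%:R `^ (- (1 + delta)) <= C * q ^+ k * q ^+ k.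
  have qE : q ^+ k * q ^+ k = (2 ^ k)%:R * (2 ^ k)%:R `^ (- (1 + delta)).
    have p0 : (2 ^ k)%:R != 0 :> R by rewrite pnatr_eq0 expn_eq0.
    rewrite opprD powRD ?p0 ?implybT// powR_inv1// mulrA divff// mul1r.
    rewrite natrX -[2 ^+ k]powR_mulrn// -powRrM /q /r -!exprM -powR_mulrn ?powR_ge0//.
    rewrite -powRrM -powRD ?pnatr_eq0 ?implybT//; congr (_ `^ _).
    by rewrite natrM; field.
  apply: (@le_trans _ _ (\sum_(2 ^ k <= i < 2 ^ k + 2 ^ k) C * (2 ^ k)%:R `^ (- (1 + delta)))).
    rewrite !big_nat; apply: ler_sum => i /andP[ki _]; apply: ler_wpM2l => //.
    by apply: ler_powRN; rewrite ?ltr0n ?expn_gt0 ?ler_nat ?ltW ?addr_gt0// ltnW.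
  by rewrite sumr_const_nat addnK -[leRHS]mulrA qE -[leLHS]mulr_natl mulrCA.
have intG k : (\int[P]_w (G k w)%:E <= ((C + 1) * (k.+1%:R ^+ 2 * q ^+ k))%:E)%E.
  have c0 : 0 <= k.+1%:R / q ^+ k by rewrite divr_ge0// ltW.
  rewrite /G; under eq_integral do rewrite EFinM.
  have mDk : measurable_fun setT (fun w => k.+1%:R / q ^+ k * D k w).
    by apply: measurable_funM.
  rewrite ge0_integralZl_EFin//; last 2 first.
  - by move=> w _; rewrite lee_fin addr_ge0 ?(ltW (qk0 _))// mulr_ge0.
  - by apply/measurable_EFinP; exact: measurable_funD.
  under eq_integral do rewrite EFinD.
  rewrite ge0_integralD//; last 3 first.
  - by move=> w _; rewrite lee_fin mulr_ge0.
  - exact/measurable_EFinP.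
  - by move=> w _; rewrite lee_fin ltW.
  under eq_integral do rewrite EFinM.
  rewrite ge0_integralZl_EFin//; last 2 first.
  - by move=> w _; rewrite lee_fin.
  - exact/measurable_EFinP.
  rewrite integral_cst//= probability_setT mule1.
  apply: le_trans (_ : (2^-1)%:E * ((k.+1%:R / q ^+ k)%:E *
      (k.+1%:R * (C * q ^+ k * q ^+ k))%:E + (q ^+ k)%:E) <= _)%E.
    rewrite lee_pmul2l// leeD2r// lee_wpmul2l ?lee_fin//.
    apply: le_trans (le_dyadic_energy k (2 ^ k)%N mS Sv) _.
    by rewrite lee_fin ler_wpM2l.
  rewrite -(EFinM (k.+1%:R / q ^+ k)) -EFinD -EFinM lee_fin.
  have -> : k.+1%:R / q ^+ k * (k.+1%:R * (C * q ^+ k * q ^+ k))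
      = C * (k.+1%:R ^+ 2 * q ^+ k) by field; rewrite gt_eqF.
  have : q ^+ k <= k.+1%:R ^+ 2 * q ^+ k.
    by rewrite ler_peMl ?(ltW (qk0 _))// expr_ge1// ler1n.
  have : 0 <= C * (k.+1%:R ^+ 2 * q ^+ k) by rewrite mulr_ge0// mulr_ge0// ?sqr_ge0 ?ltW.
  have := qk0 k; rewrite [(C + 1) * _]mulrDl mul1r.
  by set u := _ * (_ * q ^+ k); set v := _ * q ^+ k; set z := q ^+ k; lra.
have : {ae P, forall w, cvgn (series (G ^~ w))}.
  apply: (ae_cvg_series mG G0 intG).
  by apply: is_cvg_seriesZ; apply: cvg_series_sqr_geometric; rewrite r0.
apply: filterS => w; apply: dyadic_cvg => k n /andP[kn nk].
have := @dyadic_energy_bound _ (S ^~ w) k (2 ^ k) n.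
rewrite kn addnn -mul2n -expnS nk => /(_ isT); rewrite -/(D k w) => le_sqr.
set y := S n w - _ in le_sqr *.
apply: le_trans (norm_le_sqr y (qk0 k)) _; rewrite ler_pM2l ?invr_gt0// lerD2r.
by rewrite mulrC [leRHS]mulrAC ler_pM2r ?invr_gt0.
Qed.

End AlmostSure.

(** * Measurability of limits *)
Section MeasurableLimit.
Context {R : realType} {d : measure_display} {T : measurableType d}.

(** Through the Cauchy criterion, which only involves countable operations. *)
Lemma measurable_cvgn (u : nat -> T -> R) : (forall n, measurable_fun setT (u n)) ->
  measurable [set w | cvgn (u ^~ w)].
Proof.
move=> mu.
pose E k m n := [set w | `|u m w - u n w| < k.+1%:R^-1].
have -> : [set w | cvgn (u ^~ w)] =
    \bigcap_k \bigcup_N \bigcap_(m in [set m | (N <= m)%N])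
      \bigcap_(n in [set n | (N <= n)%N]) E k m n.
  apply/seteqP; split => w /=.
    move=> /cvg_ex[l /cvgrPdist_lt ul] k _.
    have e0 : 0 < k.+1%:R^-1 / 2 :> R by rewrite divr_gt0 ?invr_gt0.
    have [N _ HN] := ul _ e0; exists N => // m /= Nm n /= Nn; rewrite /E/=.
    rewrite -(subrK l (u m w)) -addrA (le_lt_trans (ler_normD _ _))//.
    by rewrite [ltRHS]Num.Theory.splitr ltrD//; [rewrite distrC|]; exact: HN.
  move=> H; apply/cauchy_cvgP/cauchyP => e e0.
  have [k ke] : exists k, k.+1%:R^-1 < e.
    exists (Num.truncn e^-1); rewrite -[ltRHS]invrK ltf_pV2 ?posrE ?invr_gt0//.
    by rewrite truncnS_gt.
  have [N _ HN] := H k I; exists (u N w), N => // n /= Nn.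
  rewrite /ball/=; apply: lt_trans ke.
  exact: (HN N (leqnn N) n Nn).
apply: bigcapT_measurable => k; apply: bigcupT_measurable => N.
apply: bigcap_measurable => [|m _]; first by exists N => /=.
apply: bigcap_measurable => [|n _]; first by exists N => /=.
rewrite /E.
have := @measurable_fun_ltr _ _ _ setT (fun w => `|u m w - u n w|) (fun=> k.+1%:R^-1).
move=> /(_ _ _ measurableT [set true]); rewrite setTI; apply => //.
by apply: measurableT_comp => //; exact: measurable_funB.
Qed.

Lemma measurable_limn (u : nat -> T -> R) : (forall n, measurable_fun setT (u n)) ->
  measurable_fun setT (fun w => limn (u ^~ w)).
Proof.
move=> mu; set D := [set w | cvgn (u ^~ w)].
have mD : measurable D by exact: measurable_cvgn.
rewrite -(setUv D); apply/measurable_funU => //; first exact: measurableC.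
split.
  apply: (measurable_fun_cvg (h := u)) => [n|w Dw]; first exact: measurable_funTS.
  exact: Dw.
(* where the sequence diverges the limit is the default value *)
apply: (eq_measurable_fun (fun=> point)); last exact: measurable_cst.
move=> w /set_mem Dw; apply/esym/getPN => l ul.
by apply: Dw; apply/cvg_ex; exists l.
Qed.

End MeasurableLimit.

(** * Independence of disjoint subfamilies *)
Section IndependentSubfamilies.
Context {R : realType} {d : measure_display} {T : measurableType d}.
Variable P : probability T R.
Context {I : eqType} (D : set I) (F : I -> set (set T)).
Hypothesis indF : mutually_independent P D F.
Hypothesis measF : forall i, D i -> F i `<=` measurable.
Hypothesis F_setT : forall i, D i -> F i setT.
Hypothesis F_setI : forall i, D i -> setI_closed (F i).
Implicit Types (J K : set I) (A B : set T).

(** The pi-system generating the sigma-algebra of the subfamily indexed by [J]. *)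
Definition cylinders J : set (set T) :=
  [set B | exists s (A : I -> set T), [/\ uniq s, forall i, i \in s -> J i /\ F i (A i)
                         & B = \big[setI/setT]_(i <- s) A i] ].

Lemma big_setIP (s : seq I) (A : I -> set T) w :
  (\big[setI/setT]_(i <- s) A i) w <-> forall i, i \in s -> A i w.
Proof.
elim: s => [|j s IH]; first by rewrite big_nil.
rewrite big_cons; split=> [[Aj /IH As] i|H].
  by rewrite inE => /predU1P[->//|]; exact: As.
split; first by apply: H; rewrite inE eqxx.
by apply/IH => i si; apply: H; rewrite inE si orbT.
Qed.

Lemma cylinders_setT J : cylinders J setT.
Proof. by exists [::], (fun=> setT); split => //; rewrite big_nil. Qed.

Lemma sub_cylinders J i A : J i -> F i A -> cylinders J A.
Proof.
move=> Ji FA; exists [:: i], (fun=> A); split => //; last by rewrite big_seq1.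
by move=> j; rewrite inE => /eqP ->.
Qed.

Lemma cylinders_setI J : J `<=` D -> setI_closed (cylinders J).
Proof.
move=> JD _ _ [s1 [A1 [u1 sA1 ->]]] [s2 [A2 [u2 sA2 ->]]].
pose ext (s : seq I) (A : I -> set T) i := if i \in s then A i else setT.
exists (undup (s1 ++ s2)), (fun i => ext s1 A1 i `&` ext s2 A2 i); split.
- exact: undup_uniq.
- move=> i; rewrite mem_undup mem_cat => si.
  have Ji : J i by case/orP: si => [/sA1[]|/sA2[]].
  split => //; apply: F_setI; first exact: JD.
    by rewrite /ext; case: ifPn => [/sA1[]//|_]; apply/F_setT/JD.
  by rewrite /ext; case: ifPn => [/sA2[]//|_]; apply/F_setT/JD.
- apply/seteqP; split => w.
    move=> [/big_setIP H1 /big_setIP H2]; apply/big_setIP => i _; split; rewrite /ext.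
      by case: ifPn => // /H1.
    by case: ifPn => // /H2.
  move=> /big_setIP H; split; apply/big_setIP => i si.
    by have [] := H i; rewrite ?mem_undup ?mem_cat ?si// /ext si.
  by have [] := H i; rewrite ?mem_undup ?mem_cat ?si ?orbT// /ext si.
Qed.

Lemma cylinders_measurable J : J `<=` D -> cylinders J `<=` measurable.
Proof.
move=> JD _ [s [A [_ sA ->]]]; rewrite big_seq.
by apply: bigsetI_measurable => i /sA[Ji]; apply/measF/JD.
Qed.

Lemma indep_cylinders J K A B : J `<=` D -> K `<=` D -> J `&` K = set0 ->
  cylinders J A -> cylinders K B -> P (A `&` B) = (P A * P B)%E.
Proof.
move=> JD KD JK [s1 [A1 [u1 sA1 ->]]] [s2 [A2 [u2 sA2 ->]]].
have disj i : i \in s2 -> i \notin s1.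
  move=> /sA2[Ki _]; apply/negP => /sA1[Ji _].
  by have : (J `&` K) i by []; rewrite JK.
pose C i := if i \in s1 then A1 i else A2 i.
have E1 : \big[setI/setT]_(i <- s1) A1 i = \big[setI/setT]_(i <- s1) C i.
  by apply: eq_big_seq => i si; rewrite /C si.
have E2 : \big[setI/setT]_(i <- s2) A2 i = \big[setI/setT]_(i <- s2) C i.
  by apply: eq_big_seq => i /disj si; rewrite /C (negbTE si).
have H1 i : i \in s1 -> D i /\ F i (C i).
  by move=> si; have [Ji ?] := sA1 _ si; rewrite /C si; split => //; exact: JD.
have H2 i : i \in s2 -> D i /\ F i (C i).
  move=> si; have [Ki ?] := sA2 _ si; rewrite /C (negbTE (disj _ si)).
  by split => //; exact: KD.
rewrite E1 E2 -big_cat/= (indF (s := s1 ++ s2)); last 2 first.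
- rewrite cat_uniq u1 u2 andbT/=; apply/hasPn => i; exact: disj.
- by move=> i; rewrite mem_cat => /orP[/H1|/H2].
by rewrite big_cat/= !indF.
Qed.

(** Two measures that agree on a pi-system agree on the sigma-algebra it
    generates. This is applied once for each subfamily: first [B] is a fixed
    cylinder, and [A'] ranges over the generated sigma-algebra, or conversely. *)
Lemma indep_g_sigma J K A B : J `<=` D -> K `<=` D -> J `&` K = set0 ->
  <<s cylinders J >> A -> <<s cylinders K >> B -> P (A `&` B) = (P A * P B)%E.
Proof.
move=> JD KD JK.
have extend L C : L `<=` D -> measurable C ->
    (forall B', cylinders L B' -> P (B' `&` C) = (P B' * P C)%E) ->
    forall B', <<s cylinders L >> B' -> P (B' `&` C) = (P B' * P C)%E.
  move=> LD mC H B' sB'.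
  have fC : 0 <= fine (P C) by rewrite fine_ge0.
  have := @g_sigma_algebra_measure_unique _ _ _ _ (cylinders_measurable LD)
    (fun=> setT) (fun=> cylinders_setT L) _
    (mrestr P mC) (mscale (NngNum fC) P) (cylinders_setI LD).
  rewrite bigcup_const; last by exists 0%N.
  have mscaleE A' : mscale (NngNum fC) P A' = (P A' * P C)%E.
    by rewrite /mscale/= fineK ?fin_num_measure// muleC.
  move=> /(_ erefl) h; rewrite -mscaleE; apply: h sB'.
  - by move=> B'' cB''; apply: etrans (esym (mscaleE _)); exact: H.
  - by move=> _; change (P (setT `&` C) < +oo)%E; rewrite setTI ltey_eq fin_num_measure.
move=> sA sB.
have mB : measurable B by exact: (smallest_sub (@sigma_algebra_measurable _ T) (cylinders_measurable KD)).
apply: (extend _ _ JD mB _ _ sA) => A' cA'.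
rewrite setIC muleC.
apply: (extend _ _ KD (cylinders_measurable JD cA') _ _ sB) => B' cB'.
by rewrite setIC muleC; exact: (indep_cylinders JD KD JK).
Qed.

End IndependentSubfamilies.

Section IndependentProduct.
Context {R : realType} {d : measure_display} {T : measurableType d}.
Variable P : probability T R.

(** The joint law is the product of the laws, and Tonelli's theorem applies to it. *)
Lemma ge0_expectM (X V : T -> R) :
    bounded_rv X -> bounded_rv V -> (forall w, 0 <= X w) -> (forall w, 0 <= V w) ->
    (forall A B, measurable A -> measurable B ->
      P (X @^-1` A `&` V @^-1` B) = (P (X @^-1` A) * P (V @^-1` B))%E) ->
  \int[P]_w (X w * V w) = \int[P]_w X w * \int[P]_w V w.
Proof.
move=> bX bV X0 V0 XV.
have mX := bounded_rv_measurable bX; have mV := bounded_rv_measurable bV.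
have mXV : measurable_fun setT (fun w => (X w, V w)) by exact: measurable_fun_pair.
pose X' : {RV P >-> R} := mfun_Sub (mem_set mX).
pose V' : {RV P >-> R} := mfun_Sub (mem_set mV).
pose W : {RV P >-> (R * R)%type} := mfun_Sub (mem_set mXV).
have WE B : measurable B -> (distribution P X' \x distribution P V')%E B = distribution P W B.
  apply: product_measure_unique => A1 A2 mA1 mA2.
  rewrite /distribution /pushforward/= -XV//; congr (P _).
pose f (z : R * R) : \bar R := (`|z.1| * `|z.2|)%:E.
have mf : measurable_fun setT f.
  by apply/measurable_EFinP; apply: measurable_funM; apply: measurableT_comp.
have f0 z : (0 <= f z)%E by rewrite lee_fin mulr_ge0.
have mnorm : measurable_fun setT (fun x : R => `|x|%:E) by exact/measurable_EFinP.
apply: EFin_inj; rewrite EFinM -!bounded_rvE//; last exact: bounded_rvM.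
transitivity (\int[distribution P W]_z f z)%E.
  rewrite ge0_integral_distribution//; apply: eq_integral => w _.
  by rewrite /f/= !ger0_norm.
rewrite (eq_measure_integral (distribution P X' \x distribution P V')%E); last first.
  by move=> B mB _; exact/esym/WE.
rewrite fubini_tonelli1//.
transitivity (\int[distribution P X']_x (`|x|%:E * \int[P]_w (V w)%:E))%E.
  apply: eq_integral => x _; rewrite /fubini_F /f/=.
  under eq_integral do rewrite EFinM.
  rewrite ge0_integralZl//; congr (_ * _)%E.
  rewrite ge0_integral_distribution//; apply: eq_integral => w _.
  by rewrite /= ger0_norm.
rewrite ge0_integralZr//; last by apply: integral_ge0 => w _; rewrite lee_fin.
congr (_ * _)%E; rewrite ge0_integral_distribution//; apply: eq_integral => w _.
by rewrite /= ger0_norm.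
Qed.

(** Adding a bound to each variable reduces to the nonnegative case. *)
Lemma expectM (X V : T -> R) : bounded_rv X -> bounded_rv V ->
    (forall A B, measurable A -> measurable B ->
      P (X @^-1` A `&` V @^-1` B) = (P (X @^-1` A) * P (V @^-1` B))%E) ->
  \int[P]_w (X w * V w) = \int[P]_w X w * \int[P]_w V w.
Proof.
move=> bX bV XV; have [_ [K XK]] := bX; have [_ [L VL]] := bV.
have bK : bounded_rv (fun _ : T => K) := bounded_rv_cst K.
have bL : bounded_rv (fun _ : T => L) := bounded_rv_cst L.
have shift (f : T -> R) c B : (fun w => f w + c) @^-1` B = f @^-1` ((fun x => x + c) @^-1` B).
  by [].
have mshift (c : R) B : measurable B -> measurable ((fun x : R => x + c) @^-1` B).
  move=> mB; rewrite -[X in measurable X]setTI.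
  by apply: (measurable_funD (@measurable_id _ _ _) (@measurable_cst _ _ _ _ setT c)).
have := @ge0_expectM (fun w => X w + K) (fun w => V w + L)
  (bounded_rvD bX bK) (bounded_rvD bV bL).
have pos (f : T -> R) c : (forall w, `|f w| <= c) -> forall w, 0 <= f w + c.
  by move=> fc w; have := fc w; rewrite ler_norml -lerBlDr sub0r => /andP[].
move=> /(_ (pos _ _ XK) (pos _ _ VL)) H.
have {}H := H (fun A B mA mB => XV _ _ (mshift K A mA) (mshift L B mB)).
move: H; rewrite !expectD// !expect_cst.
have -> : \int[P]_w ((X w + K) * (V w + L)) =
  \int[P]_w (X w * V w) + L * \int[P]_w X w + K * \int[P]_w V w + K * L.
  have bXV := bounded_rvM bX bV.
  have bLX := bounded_rvM bL bX; have bKV := bounded_rvM bK bV.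
  transitivity (\int[P]_w (X w * V w + L * X w + K * V w + K * L)).
    by apply: eq_Rintegral => w _; ring.
  have b2 := bounded_rvD bXV bLX; have b3 := bounded_rvD b2 bKV.
  rewrite (expectD P b3 (bounded_rv_cst (K * L))) (expectD P b2 bKV) (expectD P bXV bLX).
  by rewrite (expectZ P L bX) (expectZ P K bV) expect_cst.
set x := \int[P]_w X w; set y := \int[P]_w V w; set z := \int[P]_w _ => H.
have -> : z = (z + L * x + K * y + K * L) - (L * x + K * y + K * L) by ring.
by rewrite H; ring.
Qed.

End IndependentProduct.

(** * Clusters through their roots *)
Section ClusterRoots.
Variables (u : nat -> nat) (e : nat -> bool).

(** The first argument bounds the number of steps towards the root; [k] of them
    suffice from node [k] since labels decrease. *)
Fixpoint root_iter n k : nat :=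
  if n is n'.+1 then
    if (2 <= k)%N && e k then root_iter n' (u k) else k
  else k.

Definition cluster_root k := root_iter k k.

Definition cluster_count n i : nat := \sum_(1 <= k < n.+1) (cluster_root k == i).

Hypothesis u_range : forall k, (2 <= k)%N -> (1 <= u k <= k.-1)%N.

Lemma parent_lt k : (2 <= k)%N -> (u k < k)%N.
Proof. by move=> k2; have /andP[_ ] := u_range k2; lia. Qed.

Lemma root_iter_stable k n m : (k <= n)%N -> (k <= m)%N ->
  root_iter n k = root_iter m k.
Proof.
elim/ltn_ind: k n m => k IH [|n] [|m]; rewrite ?leqn0; try by move=> /eqP->//= _; case: ifP.
- by move=> _ /eqP -> /=.
- move=> kn km /=; case: ifP => // /andP[k2 _].
  by have uk := parent_lt k2; apply: IH => //; lia.
Qed.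

Lemma cluster_rootE k :
  cluster_root k = if (2 <= k)%N && e k then cluster_root (u k) else k.
Proof.
case: k => [//|k]; rewrite {1}/cluster_root [in LHS]/=; case: ifP => // /andP[k2 _].
by apply: root_iter_stable => //; have := parent_lt k2; lia.
Qed.

Lemma cluster_root_le k : (cluster_root k <= k)%N.
Proof.
elim/ltn_ind: k => k IH; rewrite cluster_rootE; case: ifP => // /andP[k2 _].
by have uk := parent_lt k2; have := IH _ uk; lia.
Qed.

Lemma cluster_root0 : cluster_root 0 = 0%N. Proof. by []. Qed.

Lemma cluster_root_gt0 k : (0 < k)%N -> (0 < cluster_root k)%N.
Proof.
elim/ltn_ind: k => k IH k0; rewrite cluster_rootE; case: ifP => // /andP[k2 _].
by apply: IH; [exact: parent_lt|case/andP: (u_range k2)].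
Qed.

Lemma cluster_root_idem k : cluster_root (cluster_root k) = cluster_root k.
Proof.
elim/ltn_ind: k => k IH; rewrite [cluster_root k]cluster_rootE.
case: ifPn => [/andP[k2 _]|kN]; first by apply: IH; exact: parent_lt.
by rewrite cluster_rootE (negbTE kN).
Qed.

Lemma perc_edge_sym n : connect_sym (@perc_edge u e n).
Proof. by apply: sym_connect_sym => a b; rewrite /perc_edge orbC. Qed.

Lemma perc_edge_root n (a b : 'I_n.+1) :
  perc_edge u e a b -> cluster_root a = cluster_root b.
Proof.
case/orP => /and3P[k2 ek /eqP <-].
  by rewrite [LHS]cluster_rootE k2 ek.
by rewrite [RHS]cluster_rootE k2 ek.
Qed.

Lemma connect_root n (a b : 'I_n.+1) :
  connect (@perc_edge u e n) a b -> cluster_root a = cluster_root b.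
Proof.
case/connectP => s sP ->; elim: s a sP => //= c s IH a /andP[/perc_edge_root -> /IH].
by [].
Qed.

Lemma connect_to_root n (v r : 'I_n.+1) : r = cluster_root v :> nat ->
  connect (@perc_edge u e n) v r.
Proof.
case: v => k kn /=; elim/ltn_ind: k kn => k IH kn; rewrite cluster_rootE.
case: ifPn => [/andP[k2 ek] rE|_ rE]; last by rewrite (_ : r = Ordinal kn)//; exact: val_inj.
have uk := parent_lt k2; have un : (u k < n.+1)%N by exact: ltn_trans uk kn.
apply: connect_trans (IH _ uk un rE); apply: connect1.
by rewrite /perc_edge/= k2 ek eqxx.
Qed.

(** Two nodes are connected exactly when the paths along kept edges towards
    smaller labels end at the same node, and this node has the smallest label of
    the component. *)
Lemma card_cluster n i : (0 < i)%N -> #|Defs.cluster u e n i| = cluster_count n i.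
Proof.
move=> i0; have memE (v : 'I_n.+1) :
    (v \in Defs.cluster u e n i) = (0 < v)%N && (cluster_root v == i).
  rewrite inE; apply/existsP/andP => [[r /and4P[_ /eqP ri rv /forallP rmin]]|[v0 /eqP vi]].
    have rr : cluster_root r = i.
      have rt : (cluster_root r < n.+1)%N by exact: leq_ltn_trans (cluster_root_le r) (ltn_ord r).
      have := rmin (Ordinal rt); rewrite (connect_to_root (r := Ordinal rt))//= => ir.
      by apply/eqP; rewrite eqn_leq ir -[in X in (_ <= X)%N]ri cluster_root_le.
    rewrite -(connect_root rv) rr eqxx; split => //.
    by rewrite lt0n; apply/eqP => v0; move: (connect_root rv); rewrite rr v0 cluster_root0 => i0'; move: i0; rewrite i0'.
  have ilt : (i < n.+1)%N by rewrite -vi (leq_ltn_trans (cluster_root_le v)).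
  exists (Ordinal ilt); rewrite i0 eqxx/=; apply/andP; split.
    by rewrite perc_edge_sym connect_to_root.
  apply/forallP => x; apply/implyP => /connect_root/= xr.
  by rewrite -vi -cluster_root_idem vi xr cluster_root_le.
rewrite -sum1_card (eq_bigl _ _ memE) big_mkcond/=.
rewrite (big_ord_recl n) /= add0n /cluster_count big_add1/= big_mkord.
by apply: eq_bigr => k _; rewrite /bump/= add1n; case: eqP.
Qed.

Lemma cluster_countS n i :
  cluster_count n.+1 i = (cluster_count n i + (cluster_root n.+1 == i))%N.
Proof. by rewrite /cluster_count big_nat_recr. Qed.

Lemma cluster_count_eq0 n i : (n < i)%N -> cluster_count n i = 0%N.
Proof.
move=> ni; rewrite /cluster_count big_nat big1// => k /andP[_ kn].
by case: eqP => // ki; have := cluster_root_le k; lia.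
Qed.

Lemma sum_by_root (V : nmodType) n (x : nat -> V) :
  \sum_(1 <= k < n.+1) x (cluster_root k) =
  \sum_(1 <= i < n.+1) x i *+ cluster_count n i.
Proof.
rewrite [RHS](eq_bigr (fun i => \sum_(1 <= k < n.+1) x i *+ (cluster_root k == i))); last first.
  by move=> i _; rewrite /cluster_count -sumrMnr.
rewrite exchange_big_nat/= !big_nat; apply: eq_bigr => k /andP[k1 kn].
have rk0 := cluster_root_gt0 k1; have rkk := cluster_root_le k.
rewrite (bigD1_seq (cluster_root k)) ?iota_uniq//=; last by rewrite mem_index_iota; lia.
by rewrite eqxx mulr1n big1 ?addr0// => i /negbTE; rewrite eq_sym => ->.
Qed.

Lemma cluster_countS_sum n i : (0 < n)%N -> (i <= n)%N ->
  (cluster_root n.+1 == i) = e n.+1 && (cluster_root (u n.+1) == i).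
Proof.
move=> n0 ni; rewrite cluster_rootE ltnS n0/=; case: ifP => // _.
by apply/negbTE; lia.
Qed.

End ClusterRoots.

Section MeasurableRoots.
Context {d : measure_display} {T : measurableType d}.
Variables (U : nat -> T -> nat) (eps : nat -> T -> bool) (N : nat).
Hypothesis U_range : forall k, (2 <= k)%N -> forall w, (1 <= U k w <= k.-1)%N.
Hypothesis mU : forall k, (2 <= k <= N)%N -> measurable_fun setT (U k).
Hypothesis meps : forall k, (2 <= k <= N)%N -> measurable_fun setT (eps k).

Lemma measurable_eq_nat (f : T -> nat) v : measurable_fun setT f ->
  measurable_fun setT (fun w => f w == v).
Proof. by move=> mf; apply: measurable_fun_eqn => //; exact: measurable_cst. Qed.

Lemma measurable_big_or (I : Type) (s : seq I) (f : I -> T -> bool) :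
  (forall i, measurable_fun setT (f i)) ->
  measurable_fun setT (fun w => \big[orb/false]_(i <- s) f i w).
Proof.
move=> mf; elim: s => [|i s IH].
  by under eq_fun do rewrite big_nil; exact: measurable_cst.
by under eq_fun do rewrite big_cons; exact: measurable_or.
Qed.

(** On the event [U k = v] the root of [k] is the root of [v < k] if the edge is
    kept, so only finitely many tree variables are involved. *)
Lemma measurable_cluster_root k i : (k <= N)%N ->
  measurable_fun setT (fun w => cluster_root (U ^~ w) (eps ^~ w) k == i).
Proof.
elim/ltn_ind: k => k IH kN.
have [k2|k2] := ltnP k 2.
  have -> : (fun w => cluster_root (U ^~ w) (eps ^~ w) k == i) = (fun=> k == i).
    by apply/funext => w; case: k k2 {IH kN} => [|[]].
  exact: measurable_cst.
have kb : (2 <= k <= N)%N by rewrite k2.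
have -> : (fun w => cluster_root (U ^~ w) (eps ^~ w) k == i) =
    (fun w => if eps k w then
       \big[orb/false]_(v <- iota 0 k)
         ((U k w == v) && ((v < k)%N && (cluster_root (U ^~ w) (eps ^~ w) v == i)))
     else k == i).
  apply/funext => w; rewrite cluster_rootE; last by move=> l l2; exact: U_range.
  rewrite k2/=; case: ifP => // _.
  have Uk : (U k w < k)%N by apply: (@parent_lt (U ^~ w)) => // l l2; exact: U_range.
  rewrite big_has; apply/idP/hasP => [rE|[v _ /and3P[/eqP-> _]]//].
  by exists (U k w); rewrite ?mem_iota ?eqxx ?Uk.
apply: measurable_fun_ifT; [exact: meps| |exact: measurable_cst].
apply: measurable_big_or => v; apply: measurable_and; first exact/measurable_eq_nat/mU.
have [vk|vk] := boolP (v < k)%N; last exact: measurable_cst.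
by apply: IH => //; exact: leq_trans (ltnW vk) kN.
Qed.

End MeasurableRoots.

(** * Independence in the shark random swim *)
Section PreimageSystems.
Context {T V : Type} (f : T -> V) (G : set (set V)).

Lemma preimage_set_system_preimage B : G B -> preimage_set_system setT f G (f @^-1` B).
Proof. by move=> GB; exists B => //; rewrite setTI. Qed.

Lemma preimage_set_system_setT : G setT -> preimage_set_system setT f G setT.
Proof. by move=> GT; exists setT => //; rewrite preimage_setT setTI. Qed.

Lemma preimage_set_system_setI : setI_closed G -> setI_closed (preimage_set_system setT f G).
Proof.
move=> GI _ _ [A GA <-] [B GB <-]; exists (A `&` B); first exact: GI.
by rewrite preimage_setI setIACA setIid.
Qed.

End PreimageSystems.

Section BorelCoordinates.
Context {R : realType} {d : nat}.

Lemma borel_rV_setT : borel_rV (setT : set 'rV[R]_d).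
Proof. exact: (@measurableT _ (g_sigma_algebraType (@open 'rV[R]_d))). Qed.

Lemma borel_rV_setI : setI_closed (@borel_rV R d).
Proof.
by move=> A B mA mB; apply: (@measurableI _ (g_sigma_algebraType (@open 'rV[R]_d))).
Qed.

(** Coordinates are continuous and the open rays generate the Borel sets of the
    line. *)
Lemma borel_coord (j : 'I_d) (B : set R) : measurable B ->
  borel_rV ((fun v : 'rV[R]_d => v 0 j) @^-1` B).
Proof.
move=> mB; pose coord : g_sigma_algebraType (@open 'rV[R]_d) -> R := fun v => v 0 j.
have mcoord : measurable_fun setT coord.
  apply: (measurability _ (RGenOInfty.measurableE R)) => _ [_ [a ->] <-].
  rewrite setTI; apply: sub_sigma_algebra; apply: open_comp; last exact: rray_open.
  by move=> v _; exact: coord_continuous.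
by have := mcoord measurableT B mB; rewrite setTI.
Qed.

End BorelCoordinates.

Section SwimIndependence.
Context {R : realType} {disp : measure_display} {T : measurableType disp}.
Context {P : probability T R} {d : nat} {alpha p : R}.
Context {xi : nat -> T -> 'rV[R]_d} {U : nat -> T -> nat}.
Context {eps : nat -> T -> bool} {Y : nat -> T -> 'rV[R]_d}.
Hypothesis hS : shark_random_swim P alpha p xi U eps Y.
Implicit Types (J K : set (nat + nat + nat)).

(** The sample space with the sigma-algebra generated by the variables indexed by
    [J]: being a function of these variables is measurability on this space. *)
Definition sub_sigma J := g_sigma_algebraType (cylinders (srs_sigma xi U eps) J).

Lemma srs_sigma_measurable k : srs_index k -> srs_sigma xi U eps k `<=` measurable.
Proof.
case: k => [[i|k]|k] /= hk _ [B mB <-]; rewrite setTI.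
- exact: (srs_xi_rv hS hk).
- by rewrite -[_ @^-1` _]setTI; exact: (srs_U_rv hS hk).
- by rewrite -[_ @^-1` _]setTI; exact: (srs_eps_rv hS hk).
Qed.

Lemma srs_sigma_setT k : srs_index k -> srs_sigma xi U eps k setT.
Proof.
case: k => [[i|k]|k] /= _; apply: preimage_set_system_setT => //.
exact: borel_rV_setT.
Qed.

Lemma srs_sigma_setI k : srs_index k -> setI_closed (srs_sigma xi U eps k).
Proof.
case: k => [[i|k]|k] /= _; apply: preimage_set_system_setI; try exact: measurableI.
exact: borel_rV_setI.
Qed.

Lemma measurable_U_sub J k : J (inl (inr k)) ->
  measurable_fun setT (U k : sub_sigma J -> nat).
Proof.
move=> Jk _ B mB; rewrite setTI; apply: sub_sigma_algebra.
by apply: (sub_cylinders Jk); exact: preimage_set_system_preimage.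
Qed.

Lemma measurable_eps_sub J k : J (inr k) ->
  measurable_fun setT (eps k : sub_sigma J -> bool).
Proof.
move=> Jk _ B mB; rewrite setTI; apply: sub_sigma_algebra.
by apply: (sub_cylinders Jk); exact: preimage_set_system_preimage.
Qed.

Lemma measurable_xi_sub J i (j : 'I_d) : J (inl (inl i)) ->
  measurable_fun setT ((fun w => xi i w 0 j) : sub_sigma J -> R).
Proof.
move=> Jk _ B mB; rewrite setTI; apply: sub_sigma_algebra.
apply: (sub_cylinders Jk).
exact: (preimage_set_system_preimage (xi i) (borel_coord j mB)).
Qed.

Lemma expectM_sub J K (X V : T -> R) :
    J `<=` srs_index -> K `<=` srs_index -> J `&` K = set0 ->
    bounded_rv X -> bounded_rv V ->
    measurable_fun setT (X : sub_sigma J -> R) ->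
    measurable_fun setT (V : sub_sigma K -> R) ->
  \int[P]_w (X w * V w) = \int[P]_w X w * \int[P]_w V w.
Proof.
move=> JD KD JK bX bV mX mV; apply: expectM => // A B mA mB.
apply: (indep_g_sigma (srs_indep hS) srs_sigma_measurable srs_sigma_setT
  srs_sigma_setI JD KD JK).
  by have := mX measurableT A mA; rewrite setTI.
by have := mV measurableT B mB; rewrite setTI.
Qed.

End SwimIndependence.

(** * The normalised cluster sizes *)
Section ClusterMartingale.
Context {R : realType} {disp : measure_display} {T : measurableType disp}.
Context {P : probability T R} {d : nat} {alpha p : R}.
Context {xi : nat -> T -> 'rV[R]_d} {U : nat -> T -> nat}.
Context {eps : nat -> T -> bool} {Y : nat -> T -> 'rV[R]_d}.
Hypothesis hp : 0 < p < 1.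
Hypothesis hS : shark_random_swim P alpha p xi U eps Y.
Implicit Types (J K : set (nat + nat + nat)) (k m n i : nat).

Local Notation root k w := (cluster_root (U ^~ w) (eps ^~ w) k).
Local Notation subT J := (@sub_sigma R disp T d xi U eps J).

Definition root_count n i w : R := (cluster_count (U ^~ w) (eps ^~ w) n i)%:R.

(** The indices of the variables that determine the percolated tree on the first
    [n] nodes. *)
Definition tree_index n : set (nat + nat + nat) := fun x =>
  match x with
  | inl (inl _) => False
  | inl (inr l) => (2 <= l <= n)%N
  | inr l => (2 <= l <= n)%N
  end.

Let U_range := srs_U_range hS.

Let U_rangew w k : (2 <= k)%N -> (1 <= U k w <= k.-1)%N.
Proof. by move=> k2; exact: U_range. Qed.

Lemma tree_index_srs n : tree_index n `<=` srs_index.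
Proof. by case=> [[i|k]|k] //= /andP[]. Qed.

Lemma measurable_root_sub J k i : tree_index k `<=` J ->
  measurable_fun setT ((fun w => root k w == i) : subT J -> bool).
Proof.
move=> kJ; apply: (@measurable_cluster_root _ (subT J) U eps k) => // l lk.
  by apply: measurable_U_sub; exact: (kJ (inl (inr l))).
by apply: measurable_eps_sub; exact: (kJ (inr l)).
Qed.

Lemma root_countE n i w : root_count n i w = \sum_(1 <= k < n.+1) ((root k w == i)%:R : R).
Proof. by rewrite /root_count /cluster_count natr_sum. Qed.

Lemma tree_index_le m n : (m <= n)%N -> tree_index m `<=` tree_index n.
Proof.
by move=> mn [[i|k]|k] //= /andP[k2 km]; rewrite k2/=; exact: leq_trans km mn.
Qed.

Lemma measurable_root_count_sub J n i : tree_index n `<=` J ->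
  measurable_fun setT (root_count n i : subT J -> R).
Proof.
move=> nJ.
suff : bounded_rv (root_count n i : subT J -> R) by case.
rewrite (_ : root_count n i = (fun w => \sum_(1 <= k < n.+1 | (k <= n)%N) (root k w == i)%:R)).
  apply: (@bounded_rv_sum _ _ (subT J)) => k kn.
  apply: (@bounded_rv_nat _ _ (subT J)); apply: measurable_root_sub.
  exact: subset_trans (tree_index_le kn) nJ.
apply/funext => w; rewrite root_countE big_nat_cond [RHS]big_nat_cond; apply: eq_bigl => k; lia.
Qed.

Lemma bounded_root k i : bounded_rv (fun w => (root k w == i)%:R : R).
Proof.
apply: bounded_rv_nat; apply: (@measurable_cluster_root _ T U eps k) => // l /andP[l2 _].
  exact: srs_U_rv hS _ l2.
exact: srs_eps_rv hS _ l2.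
Qed.

Lemma bounded_root_count n i : bounded_rv (root_count n i).
Proof.
by rewrite (funext (root_countE n i)); apply: bounded_rv_sum => k _; exact: bounded_root.
Qed.

Lemma measurable_eqU k v : (2 <= k)%N ->
  measurable_fun setT (fun w => U k w == v).
Proof. by move=> k2; apply: measurable_eq_nat; exact: srs_U_rv hS _ k2. Qed.

Lemma expect_attach k v : (2 <= k)%N -> (1 <= v <= k.-1)%N ->
  \int[P]_w ((eps k w && (U k w == v))%:R) = p / k.-1%:R.
Proof.
move=> k2 vk.
transitivity (\int[P]_w ((eps k w)%:R * (U k w == v)%:R)).
  by apply: eq_Rintegral => w _; rewrite -mulnb natrM.
have meps := srs_eps_rv hS k2.
rewrite (expectM_sub hS (J := [set inr k]) (K := [set inl (inr k)])).
- rewrite !expect_bool//; last exact: measurable_eqU.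
  rewrite (srs_eps_law hS k2) (_ : [set w | U k w == v] = [set w | U k w = v]).
    by rewrite (srs_U_law hS k2 vk).
  by apply/seteqP; split => w /= /eqP.
- by move=> _ ->.
- by move=> _ ->.
- by apply/seteqP; split => // x [/= ->].
- exact: bounded_rv_nat.
- exact/bounded_rv_nat/measurable_eqU.
- by apply: (@measurable_fun_natb _ _ (subT _)); exact: measurable_eps_sub.
- apply: (@measurable_fun_natb _ _ (subT _)); apply: measurable_eq_nat.
  exact: measurable_U_sub.
Qed.

(** The martingale identity in weak form, tested against a variable [V] that
    depends on the first [n] nodes: node [n + 1] repeats [v] with probability
    [p / n], independently of the past, and summing over the nodes [v] of the
    cluster of [i] produces its size. Testing avoids conditional expectations. *)
Lemma expect_growth n i (V : T -> R) : (0 < n)%N -> (i <= n)%N ->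
    bounded_rv V -> measurable_fun setT (V : subT (tree_index n) -> R) ->
  \int[P]_w ((root n.+1 w == i)%:R * V w) = p / n%:R * \int[P]_w (root_count n i w * V w).
Proof.
move=> n0 ni bV mV.
have bA v : bounded_rv (fun w => (eps n.+1 w && (U n.+1 w == v))%:R : R).
  by apply: bounded_rv_nat; apply: measurable_and;
    [exact: (srs_eps_rv hS)|exact: measurable_eqU].
have bRV v : bounded_rv (fun w => (root v w == i)%:R * V w).
  by apply: bounded_rvM => //; exact: bounded_root.
transitivity (\int[P]_w (\sum_(1 <= v < n.+1)
    (eps n.+1 w && (U n.+1 w == v))%:R * ((root v w == i)%:R * V w))).
  apply: eq_Rintegral => w _.
  rewrite (cluster_countS_sum _ (U_rangew w) n0 ni).
  have Uw : (1 <= U n.+1 w <= n)%N by have := U_rangew w (_ : 2 <= n.+1)%N; exact.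
  rewrite (bigD1_seq (U n.+1 w)) ?iota_uniq//=; last by rewrite mem_index_iota; lia.
  rewrite eqxx andbT big1 ?addr0; last first.
    by move=> v; rewrite eq_sym => /negbTE ->; rewrite andbF mul0r.
  by case: (eps _ w); rewrite /= ?mul1r ?mul0r.
rewrite expect_sum => [|v _]; last exact: bounded_rvM.
transitivity (\sum_(1 <= v < n.+1) p / n%:R * \int[P]_w ((root v w == i)%:R * V w)).
  rewrite !big_nat; apply: eq_bigr => v /andP[v1 vn].
  pose J : set (nat + nat + nat) := [set inl (inr n.+1); inr n.+1].
  rewrite (expectM_sub hS (J := J) (K := tree_index n)) //.
  - by rewrite (expect_attach (v := v))//= v1 -ltnS.
  - by move=> x [->|->].
  - exact: tree_index_srs.
  - by apply/seteqP; split => // x [[->|->]] /=; rewrite ltnn andbF.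
  - apply: (@measurable_fun_natb _ _ (subT _)); apply: measurable_and.
      by apply: measurable_eps_sub; right.
    by apply: measurable_eq_nat; apply: measurable_U_sub; left.
  - apply: (@measurable_funM _ (subT _)) => //.
    apply: (@measurable_fun_natb _ _ (subT _)); apply: measurable_root_sub.
    exact: tree_index_le.
rewrite -mulr_sumr -expect_sum//; congr (_ * _); apply: eq_Rintegral => w _.
by rewrite root_countE mulr_suml.
Qed.

(** The martingale of the cluster sizes. *)
Definition size_mg i n w : R := root_count n i w / growth p n.

Lemma bounded_size_mg i n : bounded_rv (size_mg i n).
Proof. by apply: bounded_rvM; [exact: bounded_root_count|exact: bounded_rv_cst]. Qed.

Lemma measurable_size_mg_sub J i n : tree_index n `<=` J ->
  measurable_fun setT (size_mg i n : subT J -> R).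
Proof.
move=> nJ; apply: (@measurable_funM _ (subT J)); first exact: measurable_root_count_sub.
exact: measurable_cst.
Qed.

Lemma root_count_eq0 n i w : (n < i)%N -> root_count n i w = 0.
Proof. by move=> ni; rewrite /root_count (cluster_count_eq0 _ (U_rangew w)). Qed.

Lemma root_countS n i w : root_count n.+1 i w = root_count n i w + (root n.+1 w == i)%:R.
Proof. by rewrite /root_count cluster_countS natrD. Qed.

Lemma size_mg_incr n i w : (0 < n)%N -> size_mg i n.+1 w - size_mg i n w =
  (growth p n.+1)^-1 * ((root n.+1 w == i)%:R - p / n%:R * root_count n i w).
Proof.
move=> n0; have g0 := growth_gt0 hp n.
have g1 := growth_gt0 hp n.+1; rewrite /size_mg root_countS.
move: g1; rewrite growthS// => g1; have nR : 0 < n%:R :> R by rewrite ltr0n.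
have := g1; rewrite pmulr_lgt0// => h.
have e : 1 + p / n%:R = (n%:R + p) / n%:R by field; rewrite gt_eqF.
move: h; rewrite e pmulr_lgt0 ?invr_gt0// => h.
by field; rewrite !gt_eqF.
Qed.

Lemma expect_size_mg_incr n i (V : T -> R) : (0 < n)%N -> (i <= n)%N ->
    bounded_rv V -> measurable_fun setT (V : subT (tree_index n) -> R) ->
  \int[P]_w ((size_mg i n.+1 w - size_mg i n w) * V w) = 0.
Proof.
move=> n0 ni bV mV; have bc := bounded_rvM (bounded_root_count n i) bV.
have bR := bounded_rvM (bounded_root n.+1 i) bV.
transitivity (\int[P]_w ((growth p n.+1)^-1 *
    ((root n.+1 w == i)%:R * V w - p / n%:R * (root_count n i w * V w)))).
  by apply: eq_Rintegral => w _; rewrite size_mg_incr//; ring.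
rewrite expectZ; last by apply: bounded_rvB => //; apply: bounded_rvM => //; exact: bounded_rv_cst.
rewrite expectB//; last by apply: bounded_rvM => //; exact: bounded_rv_cst.
by rewrite expectZ// expect_growth// subrr mulr0.
Qed.

Lemma size_mg_diag i w : (0 < i)%N -> 0 <= size_mg i i w <= i%:R `^ (- p).
Proof.
case: i => // i _; rewrite /size_mg root_countS root_count_eq0// add0r.
have g0 := growth_gt0 hp i.+1.
rewrite divr_ge0 ?(ltW g0)//= powRN ler_pdivrMr//.
apply: (@le_trans _ _ 1); first by case: eqP.
by rewrite mulrC ler_pdivlMr ?powR_gt0// mul1r growth_ge.
Qed.

Lemma size_mg_ge0 i n w : 0 <= size_mg i n w.
Proof. by rewrite divr_ge0// ltW// growth_gt0. Qed.

Lemma expect_size_mg_le i n : (0 < i <= n)%N -> \int[P]_w size_mg i n w <= i%:R `^ (- p).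
Proof.
case/andP => i0; elim: n => [|n IH]; first by rewrite leqNgt i0.
rewrite leq_eqVlt ltnS => /predU1P[->|ni].
  rewrite -[leRHS](expect_cst P); apply: le_expect.
  - exact: bounded_size_mg.
  - exact: bounded_rv_cst.
  - by move=> w; have /andP[] := size_mg_diag w (ltn0Sn n).
apply: le_trans (IH ni); rewrite -subr_le0.
have b1 := bounded_size_mg i n.+1; have b0 := bounded_size_mg i n.
have n0 : (0 < n)%N by exact: leq_trans i0 ni.
rewrite -expectB// -[X in _ <= X](expect_size_mg_incr n0 ni (bounded_rv_cst (T := T) 1)); last first.
  exact: measurable_cst.
by rewrite le_eqVlt; apply/orP; left; apply/eqP/eq_Rintegral => w _; rewrite mulr1.
Qed.

(** A variance bound: the increment is [1 / growth] times a centred indicator,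
    and the indicator has mean [p / n] times the mean size. One factor
    [1 / growth] and the mean of the martingale, which is at most [i^(- p)],
    give the powers of [n] and [i]. *)
Lemma expect_size_mg_incr_sqr n i : (0 < i <= n)%N ->
  \int[P]_w ((size_mg i n.+1 w - size_mg i n w) ^+ 2) <=
    2 * n.+1%:R `^ (- (1 + p)) * i%:R `^ (- p).
Proof.
case/andP=> i0 ni; have n0 : (0 < n)%N by exact: leq_trans i0 ni.
have g0 := growth_gt0 hp n; have g1 := growth_gt0 hp n.+1.
have nR : 0 < n%:R :> R by rewrite ltr0n.
case/andP: (hp) => p0 p1.
have bc := bounded_root_count n i; have br := bounded_root n.+1 i.
have b0 := bounded_size_mg i n; have b1 := bounded_size_mg i n.+1.
have bd := bounded_rvB b1 b0.
have md : measurable_fun setT (root_count n i : subT (tree_index n) -> R).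
  exact: measurable_root_count_sub.
(* subtracting a multiple of a vanishing expectation leaves only the new indicator *)
have -> : \int[P]_w ((size_mg i n.+1 w - size_mg i n w) ^+ 2) =
    (growth p n.+1)^-1 * \int[P]_w ((root n.+1 w == i)%:R * (size_mg i n.+1 w - size_mg i n w)).
  rewrite -expectZ; last exact: bounded_rvM.
  rewrite -[RHS]subr0 -(mulr0 ((growth p n.+1)^-1 * (p / n%:R))) -(expect_size_mg_incr n0 ni bc md).
  rewrite -expectZ; last exact: bounded_rvM.
  rewrite -expectB; last 2 first.
  - by apply: bounded_rvM; [exact: bounded_rv_cst|exact: bounded_rvM].
  - by apply: bounded_rvM; [exact: bounded_rv_cst|exact: bounded_rvM].
  by apply: eq_Rintegral => w _; rewrite {1 2}size_mg_incr// size_mg_incr//; ring.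
apply: (@le_trans _ _ ((growth p n.+1)^-1 * \int[P]_w ((growth p n.+1)^-1 * (root n.+1 w == i)%:R))).
  rewrite ler_pM2l ?invr_gt0//; apply: le_expect.
  - exact: bounded_rvM.
  - by apply: bounded_rvM => //; exact: bounded_rv_cst.
  move=> w; rewrite size_mg_incr// mulrCA ler_pM2l ?invr_gt0// mulrBr.
  rewrite -[leRHS]subr0; apply: lerB; first by case: eqP => _; rewrite ?mulr1 ?mulr0.
  by rewrite mulr_ge0// mulr_ge0// ?divr_ge0 ?ltW.
rewrite expectZ//.
have -> : \int[P]_w (root n.+1 w == i)%:R = p / n%:R * growth p n * \int[P]_w size_mg i n w.
  transitivity (\int[P]_w ((root n.+1 w == i)%:R * 1)).
    by apply: eq_Rintegral => w _; rewrite mulr1.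
  rewrite expect_growth//; last exact: bounded_rv_cst.
  rewrite -[RHS]mulrA; congr (_ * _); rewrite -expectZ//; apply: eq_Rintegral => w _.
  by rewrite mulr1 /size_mg mulrC divfK// gt_eqF.
have Mle := expect_size_mg_le (_ : 0 < i <= n)%N.
rewrite i0 ni in Mle; have {}Mle := Mle isT.
have M0 : 0 <= \int[P]_w size_mg i n w by apply: expect_ge0 => w; exact: size_mg_ge0.
have gg : growth p n <= growth p n.+1.
  by rewrite growthS// ler_peMl ?(ltW g0)// lerDl divr_ge0 ?ltW.
have ginv : (growth p n.+1)^-1 <= n.+1%:R `^ (- p).
  by rewrite powRN lef_pV2 ?posrE ?powR_gt0// growth_ge.
rewrite opprD powRD ?pnatr_eq0 ?implybT// powR_inv1//.
have s1 : p / n%:R <= 2 * n.+1%:R^-1.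
  rewrite ler_pdivrMr// mulrAC ler_pdivlMr ?ltr0n//.
  apply: (@le_trans _ _ (1 * n.+1%:R)); first by rewrite ler_wpM2r// ltW.
  by rewrite mul1r -natrM ler_nat; lia.
apply: (@le_trans _ _ ((growth p n.+1)^-1 * (p / n%:R * \int[P]_w size_mg i n w))).
  rewrite ler_pM2l ?invr_gt0// (_ : _ * (_ * _ * _) =
    (growth p n / growth p n.+1) * (p / n%:R * \int[P]_w size_mg i n w)); last by ring.
  by rewrite ler_piMl ?mulr_ge0 ?divr_ge0 ?(ltW p0)// ler_pdivrMr// mul1r.
rewrite [leLHS]mulrA; apply: ler_pM => //.
- by rewrite mulr_ge0 ?invr_ge0 ?divr_ge0// ltW.
- rewrite mulrC mulrA; apply: ler_pM => //; first by rewrite divr_ge0// ltW.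
  by rewrite invr_ge0 ltW.
Qed.

(** Bounds for the second moments of the increments from [k] to [k + 1]. The
    second summand is the birth of the cluster at time [i]. *)
Definition mg_variance i k : R :=
  (i <= k)%N%:R * (2 * k.+1%:R `^ (- (1 + p)) * i%:R `^ (- p))
  + (k.+1 == i)%:R * (i%:R `^ (- p)) ^+ 2.

(** Pythagoras: the new increment is orthogonal to the previous ones. *)
Lemma expect_size_mg_dist i m n : (0 < i)%N -> (m <= n)%N ->
  \int[P]_w ((size_mg i n w - size_mg i m w) ^+ 2) <= \sum_(m <= k < n) mg_variance i k.
Proof.
move=> i0; elim: n => [|n IH].
  rewrite leqn0 => /eqP ->; rewrite big_geq//.
  by rewrite -[leRHS](expect_cst P) le_eqVlt; apply/orP; left; apply/eqP/eq_Rintegral => w _;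
    rewrite subrr expr0n.
rewrite leq_eqVlt => /predU1P[->|].
  rewrite big_geq// -[leRHS](expect_cst P) le_eqVlt.
  by apply/orP; left; apply/eqP/eq_Rintegral => w _; rewrite subrr expr0n.
rewrite ltnS => mn; rewrite big_nat_recr//=.
have bb k : bounded_rv (size_mg i k) by exact: bounded_size_mg.
pose Dn w := size_mg i n.+1 w - size_mg i n w.
have bD : bounded_rv Dn by exact: bounded_rvB.
pose V w := size_mg i n w - size_mg i m w.
have bV : bounded_rv V by exact: bounded_rvB.
have -> : \int[P]_w ((size_mg i n.+1 w - size_mg i m w) ^+ 2) =
    \int[P]_w (V w ^+ 2) + 2 * \int[P]_w (Dn w * V w) + \int[P]_w (Dn w ^+ 2).
  have bDV := bounded_rvM bD bV; have bV2 := bounded_rvX 2 bV; have bD2 := bounded_rvX 2 bD.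
  have b2 : bounded_rv (fun w => 2 * (Dn w * V w)) by apply: bounded_rvM => //; exact: bounded_rv_cst.
  have b3 := bounded_rvD bV2 b2.
  rewrite -(expectZ P 2 bDV) -(expectD P bV2 b2) -(expectD P b3 bD2).
  by apply: eq_Rintegral => w _; rewrite /Dn /V; ring.
rewrite -addrA; apply: lerD; first exact: IH.
have [ni|ni] := leqP i n.
  rewrite /Dn expect_size_mg_incr//; last 2 first.
  - by apply: leq_trans ni.
  - apply: (@measurable_funB _ (subT _)); apply: measurable_size_mg_sub => //.
    exact: tree_index_le.
  rewrite mulr0 add0r /mg_variance ni mul1r.
  apply: le_trans (expect_size_mg_incr_sqr _) _; first by rewrite i0.
  by rewrite lerDl mulr_ge0// sqr_ge0.
have M0 k w : (k < i)%N -> size_mg i k w = 0 by move=> ki; rewrite /size_mg root_count_eq0// mul0r.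
have -> : \int[P]_w (Dn w * V w) = 0.
  rewrite -[RHS](expect_cst P); apply: eq_Rintegral => w _.
  by rewrite /V !M0 ?subrr ?mulr0//; exact: leq_ltn_trans mn ni.
rewrite mulr0 add0r /mg_variance leqNgt ni/= mul0r add0r.
have [ii|ii] := eqVneq n.+1 i.
  rewrite mul1r -[leRHS](expect_cst P); apply: le_expect.
  - exact: bounded_rvX.
  - exact: bounded_rv_cst.
  move=> w; rewrite /Dn (M0 n)// subr0 ii.
  by have /andP[? ?] := size_mg_diag w i0; rewrite ler_sqr ?nnegrE ?powR_ge0.
rewrite mul0r -[leRHS](expect_cst P) le_eqVlt; apply/orP; left; apply/eqP/eq_Rintegral => w _.
by rewrite /Dn !M0 ?subrr ?expr0n//; move: ni ii; lia.
Qed.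

End ClusterMartingale.

Arguments root_count {R disp T} U eps n i w.
Arguments size_mg {R disp T} p U eps i n w.
Arguments mg_variance {R} p i k.

Section MartingaleLimit.
Context {R : realType} {disp : measure_display} {T : measurableType disp}.
Context {P : probability T R} {d : nat} {alpha p : R}.
Context {xi : nat -> T -> 'rV[R]_d} {U : nat -> T -> nat}.
Context {eps : nat -> T -> bool} {Y : nat -> T -> 'rV[R]_d}.
Hypothesis hp : 0 < p < 1.
Hypothesis hS : shark_random_swim P alpha p xi U eps Y.
Implicit Types (k m n i : nat).

Local Notation mg := (size_mg p U eps).

(** For [k >= i] and [k >= m], the decay [k^(-(1 + p))] is at most
    [k^(-(1 + th))] times [m^(- th) i^(2 th - p)]: a summable part, the rate in
    [m], and an extra smallness in [i]. *)
Lemma mg_variance_sum_le th i m n : 0 < th -> 2 * th <= p -> (0 < i)%N ->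
  \sum_(m <= k < n) mg_variance p i k <=
    (3 + 2 / th) * (i%:R `^ (th - p) * m.+1%:R `^ (- (th / 2))) ^+ 2.
Proof.
move=> th0 thp i0; set A := i%:R `^ (th - p); set B := m.+1%:R `^ (- (th / 2)).
have iR : 1 <= i%:R :> R by rewrite ler1n.
have AA : A ^+ 2 = i%:R `^ (2 * th - p) * i%:R `^ (- p).
  rewrite /A expr2 -!powRD ?(gt_eqF (lt_le_trans ltr01 iR)) ?implybT//.
  by congr (_ `^ _); ring.
have BB : B ^+ 2 = m.+1%:R `^ (- th).
  rewrite /B expr2 -powRD ?pnatr_eq0 ?implybT//.
  by congr (_ `^ _); field.
have term k : (m <= k)%N -> mg_variance p i k <=
    (A * B) ^+ 2 * (2 * k.+1%:R `^ (- (1 + th)) + (k.+1 == i)%:R).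
  move=> mk; rewrite /mg_variance mulrDr exprMn AA BB; apply: lerD.
    case: leqP => ik; last first.
      by rewrite mul0r !mulr_ge0 ?powR_ge0.
    rewrite mul1r (_ : - (1 + p) = - (1 + th) + (- th + (2 * th - p))); last by ring.
    rewrite powRD ?pnatr_eq0 ?implybT// powRD ?pnatr_eq0 ?implybT//.
    set X := k.+1%:R `^ (- (1 + th)); set Yk := i%:R `^ (- p).
    rewrite (_ : 2 * _ * Yk = (2 * X * Yk) * (k.+1%:R `^ (2 * th - p) * k.+1%:R `^ (- th))); last by ring.
    rewrite (_ : _ * _ * (2 * X) = (2 * X * Yk) * (i%:R `^ (2 * th - p) * m.+1%:R `^ (- th))); last by ring.
    rewrite ler_wpM2l ?mulr_ge0 ?powR_ge0//.
    apply: ler_pM; rewrite ?powR_ge0//.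
      by rewrite -(opprB p) ler_powRN ?ltr0n ?ler_nat ?subr_ge0// ltnW.
    by rewrite ler_powRN ?ltr0n ?ler_nat ?(ltW th0).
  have [ki|_] := eqVneq k.+1 i; last by rewrite mul0r mulr0.
  have ipE : i%:R `^ (- p) = i%:R `^ (2 * th - p) * i%:R `^ (- (2 * th)) :> R.
    rewrite -powRD ?(gt_eqF (lt_le_trans ltr01 iR)) ?implybT//.
    by congr (_ `^ _); ring.
  rewrite mul1r mulr1 expr2 mulrAC ler_wpM2r ?powR_ge0// ipE ler_wpM2l ?powR_ge0//.
  apply: (@le_trans _ _ (i%:R `^ (- th))); first by apply: ler_powR => //; lra.
  by apply: ler_powRN; rewrite ?ltr0n ?ler_nat ?(ltW th0)//; lia.
apply: (@le_trans _ _ (\sum_(m <= k < n)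
    (A * B) ^+ 2 * (2 * k.+1%:R `^ (- (1 + th)) + (k.+1 == i)%:R))).
  by rewrite !big_nat; apply: ler_sum => k /andP[mk _]; exact: term.
rewrite -mulr_sumr mulrC ler_wpM2r ?sqr_ge0// big_split/= -mulr_sumr.
have le_sum0 (f : nat -> R) : (forall k, 0 <= f k) ->
    \sum_(m <= k < n) f k <= \sum_(0 <= k < n) f k.
  move=> f0; have [mn|/ltnW nm] := leqP m n; last by rewrite big_geq// sumr_ge0.
  by rewrite [leRHS](@big_cat_nat _ _ _ m)//= lerDr sumr_ge0.
have s1 : \sum_(m <= k < n) k.+1%:R `^ (- (1 + th)) <= 1 + th^-1 :> R.
  by apply: le_trans (le_sum0 _ _) (riemann_sum_le n th0) => k; exact: powR_ge0.
have s2 : \sum_(m <= k < n) ((k.+1 == i)%:R : R) <= 1.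
  apply: le_trans (le_sum0 _ _) _ => //.
  rewrite -natr_sum -[X in _ <= X]/(1%:R) ler_nat.
  have -> : (\sum_(0 <= k < n) (k.+1 == i) = (0 < i <= n))%N.
    clear le_sum0 s1; elim: n => [|n IH]; first by rewrite big_geq//; lia.
    by rewrite big_nat_recr//= IH; lia.
  by case: (_ <= _ <= _)%N.
by have := lerD (ler_wpM2l (ler0n R 2) s1) s2; lra.
Qed.

Lemma expect_size_mg_unif th i m n : 0 < th -> 2 * th <= p -> (0 < i)%N -> (m <= n)%N ->
  \int[P]_w ((mg i n w - mg i m w) ^+ 2) <=
    (3 + 2 / th) * (i%:R `^ (th - p) * m.+1%:R `^ (- (th / 2))) ^+ 2.
Proof.
move=> th0 thp i0 mn.
by apply: le_trans (expect_size_mg_dist hp hS i0 mn) (mg_variance_sum_le _ _ th0 thp i0).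
Qed.

Lemma ae_cvg_size_mg i : (0 < i)%N -> {ae P, forall w, cvgn (mg i ^~ w)}.
Proof.
move=> i0; case/andP: (hp) => p0 p1.
pose C : R := 2 * i%:R `^ (- p) + i%:R `^ (1 + p) * (i%:R `^ (- p)) ^+ 2.
apply: (@chaining_ae_cvg _ _ _ P (mg i) C p) => //.
- by rewrite addr_ge0// !mulr_ge0 ?sqr_ge0 ?powR_ge0.
- by move=> n; apply: bounded_rv_measurable; exact: (bounded_size_mg hS).
move=> m n mn; apply: le_integral_bounded.
  by apply: bounded_rvX; apply: bounded_rvB; exact: (bounded_size_mg hS).
apply: le_trans (expect_size_mg_dist hp hS i0 mn) _.
apply: ler_sum => k _; rewrite /mg_variance /C [leRHS]mulrDl; apply: lerD.
  case: leqP => _; last by rewrite mul0r !mulr_ge0 ?powR_ge0.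
  by rewrite mul1r mulrAC.
have [ki|_] := eqVneq k.+1 i; last by rewrite mul0r !mulr_ge0 ?sqr_ge0 ?powR_ge0.
by rewrite ki mul1r mulrAC -powRD ?subrr ?powRr0 ?mul1r// pnatr_eq0 -lt0n i0 implybT.
Qed.

Definition mg_lim i w : R := limn (mg i ^~ w).

Lemma measurable_mg_lim i : measurable_fun setT (mg_lim i).
Proof.
by apply: measurable_limn => n; apply: bounded_rv_measurable; exact: (bounded_size_mg hS).
Qed.

End MartingaleLimit.

Arguments mg_lim {R disp T} p U eps i w.

(** * Coordinates of a stable vector *)
Section StableCoordinate.
Context {R : realType} {disp : measure_display} {T : measurableType disp}.
Variables (P : probability T R) (d : nat) (alpha : R) (X : T -> 'rV[R]_d) (j : 'I_d).
Hypothesis mX : random_vector X.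
Hypothesis X_law : forall theta : 'rV[R]_d,
  char_fun P X theta = Complex (expR (- (euclid_norm theta `^ alpha))) 0.
Implicit Types (lam mu : R) (k K : nat).

Let x w := X w 0 j.

Lemma measurable_coordinate : measurable_fun setT x.
Proof.
move=> _ B mB; rewrite setTI; exact: (mX (borel_coord j mB)).
Qed.

Lemma inner_scaled_basis mu (v : 'rV[R]_d) : inner (mu *: delta_mx 0 j) v = mu * v 0 j.
Proof.
rewrite /inner (bigD1 j)//= !mxE !eqxx mulr1 big1 ?addr0// => k /negbTE kj.
by rewrite !mxE kj andbF mulr0 mul0r.
Qed.

Lemma euclid_norm_scaled_basis mu : 0 <= mu -> euclid_norm (mu *: delta_mx 0 j : 'rV[R]_d) = mu.
Proof.
move=> mu0; rewrite /euclid_norm inner_scaled_basis !mxE !eqxx mulr1.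
by rewrite -expr2 sqrtr_sqr ger0_norm.
Qed.

Lemma bounded_cos mu : bounded_rv (fun w => cos (mu * x w)).
Proof.
split; last by exists 1 => w; exact: cos_max.
apply: (measurableT_comp (f := @cos R)).
  by apply: continuous_measurable_fun; exact: continuous_cos.
by apply: measurable_funM => //; exact: measurable_coordinate.
Qed.

Lemma bounded_sin mu : bounded_rv (fun w => sin (mu * x w)).
Proof.
split; last by exists 1 => w; exact: sin_max.
apply: (measurableT_comp (f := @sin R)).
  by apply: continuous_measurable_fun; exact: continuous_sin.
by apply: measurable_funM => //; exact: measurable_coordinate.
Qed.

Lemma expect_cos mu : 0 <= mu -> \int[P]_w cos (mu * x w) = expR (- (mu `^ alpha)).
Proof.
move=> mu0; have := X_law (mu *: delta_mx 0 j); rewrite /char_fun euclid_norm_scaled_basis//.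
move=> [<- _]; rewrite expectation.unlock; congr fine; apply: eq_integral => w _.
by rewrite inner_scaled_basis.
Qed.

Lemma expect_sin mu : 0 <= mu -> \int[P]_w sin (mu * x w) = 0.
Proof.
move=> mu0; have := X_law (mu *: delta_mx 0 j); rewrite /char_fun => -[_ <-].
rewrite expectation.unlock; congr fine; apply: eq_integral => w _.
by rewrite inner_scaled_basis.
Qed.

(** All moment bounds rest on this consequence of stability, by
    [1 - exp (- mu^alpha) <= mu^alpha]. *)
Lemma expect_1Bcos mu : 0 <= mu -> \int[P]_w (1 - cos (mu * x w)) <= mu `^ alpha.
Proof.
move=> mu0; rewrite expectB; [|exact: bounded_rv_cst|exact: bounded_cos].
rewrite expect_cst expect_cos//.
by have := expR_ge1Dx (- (mu `^ alpha)); lra.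
Qed.

Lemma bounded_sin_trunc lam : bounded_rv (fun w => sin_trunc lam (x w)).
Proof. by apply: bounded_rvM; [exact: bounded_sin|exact: bounded_rv_cst]. Qed.

(** The characteristic function is real. *)
Lemma expect_sin_trunc lam : 0 < lam -> \int[P]_w sin_trunc lam (x w) = 0.
Proof.
move=> lam0; transitivity (\int[P]_w (lam^-1 * sin (lam * x w))).
  by apply: eq_Rintegral => w _; rewrite mulrC.
by rewrite expectZ; [rewrite expect_sin ?mulr0// ltW|exact: bounded_sin].
Qed.

(** The square of the sine is a [1 - cos] at the double frequency. *)
Lemma expect_sin_trunc_sqr lam : 0 < lam -> alpha <= 2 ->
  \int[P]_w (sin_trunc lam (x w) ^+ 2) <= 2 * lam `^ (alpha - 2).
Proof.
move=> lam0 alpha2; have l20 : 0 <= 2 * lam by rewrite mulr_ge0// ltW.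
have -> : \int[P]_w (sin_trunc lam (x w) ^+ 2) =
    \int[P]_w ((2 * lam ^+ 2)^-1 * (1 - cos (2 * lam * x w))).
  by apply: eq_Rintegral => w _; rewrite sin_trunc_sqr// mulrC.
rewrite expectZ; last by apply: bounded_rvB; [exact: bounded_rv_cst|exact: bounded_cos].
rewrite ler_pdivrMl; last by rewrite mulr_gt0// exprn_gt0.
apply: le_trans (expect_1Bcos l20) _.
rewrite powRM ?(ltW lam0)//.
have -> : 2 * lam ^+ 2 * (2 * lam `^ (alpha - 2)) = 2 `^ 2 * lam `^ alpha.
  have -> : lam `^ alpha = lam ^+ 2 * lam `^ (alpha - 2).
    rewrite -powR_mulrn ?(ltW lam0)// -powRD ?(gt_eqF lam0) ?implybT//.
    by rewrite addrC subrK.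
  by rewrite powR_mulrn//; ring.
by rewrite ler_wpM2r ?powR_ge0// ler_powR// ler1n.
Qed.

Lemma bounded_sin_trunc_dist lam K :
  bounded_rv (fun w => `|sin_trunc (lam / 2 ^+ K) (x w) - sin_trunc lam (x w)|).
Proof. by apply/bounded_rv_norm/bounded_rvB; exact: bounded_sin_trunc. Qed.

(** The costs of the successive halvings form a geometric series of ratio
    [2^(1 - alpha)], and so the bound does not depend on [K]. This is where
    [alpha > 1] is used. *)
Lemma expect_sin_trunc_dist lam K : 0 < lam -> 1 < alpha ->
  \int[P]_w `|sin_trunc (lam / 2 ^+ K) (x w) - sin_trunc lam (x w)| <=
    (1 - 2^-1 `^ (alpha - 1))^-1 * lam `^ (alpha - 1).
Proof.
move=> lam0 alpha1; pose mu k := lam / 2 ^+ k.+1.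
have mu0 k : 0 < mu k by rewrite divr_gt0// exprn_gt0.
have bc k : bounded_rv (fun w => (mu k)^-1 * (1 - cos (mu k * x w))).
  apply: bounded_rvM; first exact: bounded_rv_cst.
  by apply: bounded_rvB; [exact: bounded_rv_cst|exact: bounded_cos].
set r := 2^-1 `^ (alpha - 1).
have r0 : 0 < r by rewrite powR_gt0// invr_gt0.
have r1 : r < 1.
  rewrite /r /powR gt_eqF ?invr_gt0// expR_lt1 pmulr_rlt0 ?subr_gt0// ln_lt0// invr_gt0//=.
  by rewrite ltr0n invf_lt1 ?ltr1n.
apply: (@le_trans _ _ (\int[P]_w (\sum_(0 <= k < K) (mu k)^-1 * (1 - cos (mu k * x w))))).
  apply: le_expect; first exact: bounded_sin_trunc_dist.
    by apply: bounded_rv_sum => k _; exact: bc.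
  move=> w; apply: le_trans (sin_trunc_dist (x w) K lam0) _.
  by apply: ler_sum => k _; rewrite mulrC.
rewrite expect_sum//.
apply: (@le_trans _ _ (\sum_(0 <= k < K) lam `^ (alpha - 1) * r ^+ k)).
  apply: ler_sum => k _; rewrite expectZ; last first.
    by apply: bounded_rvB; [exact: bounded_rv_cst|exact: bounded_cos].
  rewrite ler_pdivrMl//; apply: le_trans (expect_1Bcos (ltW (mu0 k))) _.
  rewrite -(mulr_powRB1 (ltW (mu0 k)) (lt_trans ltr01 alpha1)).
  rewrite ler_pM2l// /mu powRM ?(ltW lam0)// ?invr_ge0 ?exprn_ge0//.
  rewrite ler_wpM2l ?powR_ge0//.
  have -> : (2 ^- k.+1) `^ (alpha - 1) = r ^+ k.+1.
    by rewrite -exprVn -(powR_mulrn k.+1 (ltW r0)) /r powRAC powR_mulrn ?invr_ge0.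
  by rewrite exprS ler_piMl ?exprn_ge0 ?(ltW r0)// ltW.
rewrite -mulr_sumr mulrC ler_wpM2r ?powR_ge0//.
have -> : \sum_(0 <= k < K) r ^+ k = series (geometric 1 r) K.
  by rewrite /series/=; apply: eq_bigr => k _; rewrite mul1r.
rewrite geometric_seriesE ?lt_eqF//= mul1r ler_piMl ?invr_ge0 ?subr_ge0 ?(ltW r1)//.
by rewrite lerBlDr lerDl exprn_ge0// ltW.
Qed.

End StableCoordinate.

(** * Random combinations of the steps *)
Section PositiveIndexSums.
Context {R : realType} {disp : measure_display} {T : measurableType disp}.
Implicit Type F : nat -> T -> R.

Lemma bounded_rv_sum_nat F a N : (forall i, (a <= i)%N -> bounded_rv (F i)) ->
  bounded_rv (fun w => \sum_(a <= i < N) F i w).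
Proof.
move=> bF; under eq_fun do rewrite big_seq; apply: bounded_rv_sum => i.
by rewrite mem_index_iota => /andP[ai _]; exact: bF.
Qed.

Lemma measurable_sum_nat F a N : (forall i, (a <= i)%N -> measurable_fun setT (F i)) ->
  measurable_fun setT (fun w => \sum_(a <= i < N) F i w).
Proof.
move=> mF; elim: N => [|N IH].
  by under eq_fun do rewrite big_geq//; exact: measurable_cst.
have [Na|aN] := ltnP N a.
  by under eq_fun do rewrite big_geq//; exact: measurable_cst.
under eq_fun do rewrite big_nat_recr//=.
by apply: measurable_funD => //; exact: mF.
Qed.

Lemma cvg_sum_nat (f : nat -> nat -> R) (l : nat -> R) a N :
    (forall i, (a <= i)%N -> f k i @[k --> \oo] --> l i) ->
  \sum_(a <= i < N) f k i @[k --> \oo] --> \sum_(a <= i < N) l i.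
Proof.
move=> fl; elim: N => [|N IH].
  by rewrite big_geq//; under eq_fun do rewrite big_geq//; exact: cvg_cst.
have [Na|aN] := ltnP N a.
  by rewrite big_geq//; under eq_fun do rewrite big_geq//; exact: cvg_cst.
by rewrite big_nat_recr//=; under eq_fun do rewrite big_nat_recr//=; apply: cvgD => //; exact: fl.
Qed.

End PositiveIndexSums.

Section RandomCombinations.
Context {R : realType} {disp : measure_display} {T : measurableType disp}.
Context {P : probability T R} {d : nat} {alpha p : R}.
Context {xi : nat -> T -> 'rV[R]_d} {U : nat -> T -> nat}.
Context {eps : nat -> T -> bool} {Y : nat -> T -> 'rV[R]_d}.
Hypothesis halpha : 0 < alpha <= 2.
Hypothesis hp : 0 < p < 1.
Hypothesis halphap : 1 < alpha * p.
Hypothesis hS : shark_random_swim P alpha p xi U eps Y.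
Variable j : 'I_d.
Implicit Types (k m n i N : nat) (b : nat -> T -> R).

Local Notation subT J := (@sub_sigma R disp T d xi U eps J).

Definition step (i : nat) (w : T) : R := xi i w 0 j.
(** The inverse of the truncation level [i^(1/alpha)], the natural size of the
    largest of [i] stable steps. *)
Definition cutoff i : R := i%:R `^ (- alpha^-1).
Definition trunc_step i w : R := sin_trunc (cutoff i) (step i w).
(** Bounded approximations of the step which converge to it when [K] grows. *)
Definition refined_step K i w : R := sin_trunc (cutoff i / 2 ^+ K) (step i w).

Definition tree_indices : set (nat + nat + nat) := fun x =>
  match x with
  | inl (inl _) => False
  | inl (inr l) => (2 <= l)%N
  | inr l => (2 <= l)%N
  end.

Definition tree_coef b := forall i,
  bounded_rv (b i) /\ measurable_fun setT (b i : subT tree_indices -> R).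

Lemma tree_indices_srs : tree_indices `<=` srs_index.
Proof. by case=> [[i|k]|k]. Qed.

Lemma measurable_sub_le J K (V : T -> R) : J `<=` K ->
  measurable_fun setT (V : subT J -> R) -> measurable_fun setT (V : subT K -> R).
Proof.
move=> JK mV _ B mB; have := mV measurableT B mB; rewrite !setTI.
apply: sub_sigma_algebra2 => _ [s [A [us sA ->]]]; exists s, A; split => //.
by move=> i /sA[/JK].
Qed.

Lemma cutoff_gt0 i : (0 < i)%N -> 0 < cutoff i.
Proof. by move=> i0; rewrite powR_gt0// ltr0n. Qed.

Lemma measurable_step i : (0 < i)%N -> measurable_fun setT (step i).
Proof. by move=> i0; apply: measurable_coordinate; exact: (srs_xi_rv hS). Qed.

Lemma bounded_refined_step K i : (0 < i)%N -> bounded_rv (refined_step K i).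
Proof. by move=> i0; apply: bounded_sin_trunc; exact: (srs_xi_rv hS). Qed.

Lemma bounded_trunc_step i : (0 < i)%N -> bounded_rv (trunc_step i).
Proof. by move=> i0; apply: bounded_sin_trunc; exact: (srs_xi_rv hS). Qed.

Lemma measurable_sin_trunc (lam : R) : measurable_fun setT (sin_trunc lam).
Proof.
apply: measurable_funM => //; apply: (measurableT_comp (f := @sin R)).
  by apply: continuous_measurable_fun; exact: continuous_sin.
exact: measurable_funM.
Qed.

Lemma measurable_refined_sub J K i : J (inl (inl i)) ->
  measurable_fun setT (refined_step K i : subT J -> R).
Proof.
move=> Ji; apply: (measurableT_comp (measurable_sin_trunc _)).
exact: measurable_xi_sub.
Qed.

Lemma measurable_trunc_sub J i : J (inl (inl i)) ->
  measurable_fun setT (trunc_step i : subT J -> R).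
Proof.
move=> Ji; apply: (measurableT_comp (measurable_sin_trunc _)).
exact: measurable_xi_sub.
Qed.

Let step_index i : set (nat + nat + nat) := [set inl (inl i)].

Lemma step_index_tree i : step_index i `&` tree_indices = set0.
Proof. by apply/seteqP; split => // x [/= ->]. Qed.

(** A new truncated step is centred and independent of the tree and of the
    earlier steps, so that the cross terms vanish; within a diagonal term
    weight and step are independent. *)
Lemma expect_combo_sqr b (g : nat -> R) a N : (0 < a)%N -> tree_coef b ->
    (forall i, (0 < i)%N -> \int[P]_w (b i w ^+ 2) <= g i ^+ 2) ->
  \int[P]_w ((\sum_(a <= i < N) b i w * trunc_step i w) ^+ 2) <=
    \sum_(a <= i < N) g i ^+ 2 * (2 * cutoff i `^ (alpha - 2)).
Proof.
move=> a0 hb bg; case/andP: halpha => al0 al2.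
elim: N => [|N IH].
  rewrite big_geq// -[leRHS](expect_cst P) le_eqVlt; apply/orP; left; apply/eqP.
  by apply: eq_Rintegral => w _; rewrite big_geq// expr0n.
have [Na|aN] := ltnP N a.
  rewrite big_geq// -[leRHS](expect_cst P) le_eqVlt; apply/orP; left; apply/eqP.
  by apply: eq_Rintegral => w _; rewrite big_geq// expr0n.
have N0 : (0 < N)%N by exact: leq_trans a0 aN.
have bpart : bounded_rv (fun w => \sum_(a <= i < N) b i w * trunc_step i w).
  apply: bounded_rv_sum_nat => i ai; apply: bounded_rvM; first by case: (hb i).
  exact/bounded_trunc_step/(leq_trans a0).
have [bN mN] := hb N; have bs := bounded_trunc_step N0.
pose V w := b N w * \sum_(a <= i < N) b i w * trunc_step i w.
have bV : bounded_rv V by exact: bounded_rvM.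
have -> : \int[P]_w ((\sum_(a <= i < N.+1) b i w * trunc_step i w) ^+ 2) =
    \int[P]_w ((\sum_(a <= i < N) b i w * trunc_step i w) ^+ 2)
    + 2 * \int[P]_w (trunc_step N w * V w)
    + \int[P]_w (trunc_step N w ^+ 2 * b N w ^+ 2).
  have b1 := bounded_rvX 2 bpart.
  have b2 : bounded_rv (fun w => 2 * (trunc_step N w * V w)).
    by apply: bounded_rvM; [exact: bounded_rv_cst|exact: bounded_rvM].
  have b3 := bounded_rvM (bounded_rvX 2 bs) (bounded_rvX 2 bN).
  rewrite -(expectZ P 2 (bounded_rvM bs bV)) -(expectD P b1 b2) -(expectD P (bounded_rvD b1 b2) b3).
  by apply: eq_Rintegral => w _; rewrite big_nat_recr//= /V; ring.
have X_law := srs_xi_law hS N0; have X_rv := srs_xi_rv hS N0.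
have JD : step_index N `<=` srs_index by move=> _ ->.
pose others := srs_index `\` step_index N.
have KD : others `<=` srs_index by move=> x [].
have JK : step_index N `&` others = set0.
  by apply/seteqP; split => // x [Nx []].
have tK : tree_indices `<=` others.
  by move=> x tx; split; [exact: tree_indices_srs|move=> /= xN; rewrite xN in tx].
have ms : measurable_fun setT (trunc_step N : subT (step_index N) -> R).
  exact: measurable_trunc_sub.
have mV : measurable_fun setT (V : subT others -> R).
  apply: (@measurable_funM _ (subT _)); first exact: measurable_sub_le mN.
  under eq_fun do rewrite big_seq.
  apply: (@bounded_rv_measurable _ _ (subT others)); apply: bounded_rv_sum => i.
  rewrite mem_index_iota => /andP[ai iN].
  have bsi := bounded_trunc_step (leq_trans a0 ai); have [bi mi] := hb i.
  split; last by case: (bounded_rvM bi bsi).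
  apply: (@measurable_funM _ (subT _)); first exact: measurable_sub_le mi.
  apply: measurable_trunc_sub; split; first exact: leq_trans ai.
  by case=> iE; rewrite iE ltnn in iN.
rewrite (expectM_sub hS JD KD JK bs bV ms mV).
rewrite (expect_sin_trunc _ X_rv X_law (cutoff_gt0 N0)) mul0r mulr0 addr0.
rewrite big_nat_recr//=; apply: lerD => //.
have ms2 : measurable_fun setT ((fun w => trunc_step N w ^+ 2) : subT (step_index N) -> R).
  exact: (@measurable_funX _ (subT _)).
have mN2 : measurable_fun setT ((fun w => b N w ^+ 2) : subT tree_indices -> R).
  exact: (@measurable_funX _ (subT _)).
rewrite (expectM_sub hS JD tree_indices_srs (step_index_tree N) (bounded_rvX 2 bs)
  (bounded_rvX 2 bN) ms2 mN2).
rewrite mulrC; apply: ler_pM; rewrite ?bg//.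
- by apply: expect_ge0 => w; exact: sqr_ge0.
- by apply: expect_ge0 => w; exact: sqr_ge0.
exact: (expect_sin_trunc_sqr _ X_rv X_law (cutoff_gt0 N0) al2).
Qed.

Lemma expect_norm_le (f : T -> R) (g : R) : bounded_rv f -> 0 < g ->
  \int[P]_w (f w ^+ 2) <= g ^+ 2 -> \int[P]_w `|f w| <= g.
Proof.
move=> bf g0 fg; have bf2 := bounded_rvX 2 bf.
have bq : bounded_rv (fun w => g^-1 * f w ^+ 2) by apply: bounded_rvM => //; exact: bounded_rv_cst.
have bqg := bounded_rvD bq (bounded_rv_cst (T := T) g).
apply: (@le_trans _ _ (\int[P]_w (2^-1 * (g^-1 * f w ^+ 2 + g)))).
  apply: le_expect; first exact: bounded_rv_norm.
    by apply: bounded_rvM => //; exact: bounded_rv_cst.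
  by move=> w; exact: norm_le_sqr.
rewrite expectZ// expectD//; last exact: bounded_rv_cst.
rewrite expectZ// expect_cst ler_pdivrMl// mulr2n mulrDl mul1r lerD2r.
by rewrite ler_pdivrMl// -expr2.
Qed.

Definition tail_const : R := (1 - 2^-1 `^ (alpha - 1))^-1.

Let alpha_gt1 : 1 < alpha.
Proof.
case/andP: hp => p0 p1; case/andP: halpha => al0 _.
by apply: lt_trans halphap _; rewrite gtr_pMr.
Qed.

Lemma expect_refined_dist b (g : nat -> R) K i : (0 < i)%N -> tree_coef b ->
    0 < g i -> \int[P]_w (b i w ^+ 2) <= g i ^+ 2 ->
  \int[P]_w (`|refined_step K i w - trunc_step i w| * `|b i w|) <=
    tail_const * cutoff i `^ (alpha - 1) * g i.
Proof.
move=> i0 hb g0 bg; have [bi mi] := hb i.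
have X_law := srs_xi_law hS i0; have X_rv := srs_xi_rv hS i0.
have bd : bounded_rv (fun w => `|refined_step K i w - trunc_step i w|).
  apply/bounded_rv_norm/bounded_rvB; first exact: bounded_refined_step.
  exact: bounded_trunc_step.
have JD : step_index i `<=` srs_index by move=> _ ->.
have md : measurable_fun setT ((fun w => `|refined_step K i w - trunc_step i w|) : subT (step_index i) -> R).
  apply: (@measurableT_comp _ _ _ (subT _)) => //; apply: (@measurable_funB _ (subT _)).
    exact: measurable_refined_sub.
  exact: measurable_trunc_sub.
have mni : measurable_fun setT ((fun w => `|b i w|) : subT tree_indices -> R).
  exact: (@measurableT_comp _ _ _ (subT _)).
rewrite (expectM_sub hS JD tree_indices_srs (step_index_tree i) bd (bounded_rv_norm bi) md mni).
apply: ler_pM; rewrite ?expect_ge0//; last exact: expect_norm_le.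
exact: (expect_sin_trunc_dist _ X_rv X_law _ (cutoff_gt0 i0) alpha_gt1).
Qed.

(** Half of the room left by the condition [alpha p > 1]. *)
Definition decay : R := (p - alpha^-1) / 2.

Lemma decay_gt0 : 0 < decay.
Proof.
case/andP: halpha => al0 _; rewrite divr_gt0// subr_gt0.
by rewrite -(ltr_pM2l al0) mulfV ?gt_eqF.
Qed.

Lemma decay_le : 2 * decay <= p.
Proof.
by case/andP: halpha => al0 _; rewrite mulrC divfK// lerBlDr lerDl invr_ge0 ltW.
Qed.

(** The bookkeeping of exponents: squared weights times second moments of
    truncated steps decay faster than [1 / i]. *)
Lemma trunc_weightE i : (0 < i)%N ->
  (i%:R `^ (decay - p)) ^+ 2 * cutoff i `^ (alpha - 2) = i%:R `^ (- (1 + 2 * decay)) :> R.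
Proof.
move=> i0; have iR : i%:R != 0 :> R by rewrite pnatr_eq0 -lt0n.
case/andP: halpha => al0 _; rewrite /cutoff -powRrM expr2 -!powRD ?iR ?implybT//.
by congr (_ `^ _); rewrite /decay; field; rewrite gt_eqF.
Qed.

(** The same for weights times first moments of remainders. *)
Lemma rest_weightE i : (0 < i)%N ->
  i%:R `^ (decay - p) * cutoff i `^ (alpha - 1) = i%:R `^ (- (1 + decay)) :> R.
Proof.
move=> i0; have iR : i%:R != 0 :> R by rewrite pnatr_eq0 -lt0n.
case/andP: halpha => al0 _; rewrite /cutoff -powRrM -!powRD ?iR ?implybT//.
by congr (_ `^ _); rewrite /decay; field; rewrite gt_eqF.
Qed.

Definition l1_const (G : R) : R :=
  2^-1 * (G ^+ 2 * 2 * (1 + (2 * decay)^-1) + 1) + G * tail_const * (1 + decay^-1).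

Lemma tail_const_ge0 : 0 <= tail_const.
Proof.
rewrite invr_ge0 subr_ge0 /powR gt_eqF ?invr_gt0// expR_le1.
by rewrite pmulr_rle0 ?subr_gt0// ln_le0// invf_le1// ler1n.
Qed.

(** The truncated parts are bounded in [L^2], the remainders in [L^1]. The scale
    [B] in [norm_le_sqr] makes the first bound linear in [B] as well. The steps
    are approached by bounded variables and Fatou's lemma. *)
Lemma integral_combo_le b G B N : 0 < G -> 0 < B -> tree_coef b ->
    (forall i, (0 < i)%N ->
      \int[P]_w (b i w ^+ 2) <= (G * (i%:R `^ (decay - p) * B)) ^+ 2) ->
  (\int[P]_w (`|\sum_(1 <= i < N.+1) b i w * step i w|)%:E <= (l1_const G * B)%:E)%E.
Proof.
move=> G0 B0 hb bG; have th0 := decay_gt0.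
pose g i : R := G * (i%:R `^ (decay - p) * B).
have g0 i : (0 < i)%N -> 0 < g i by move=> i0; rewrite !mulr_gt0// powR_gt0 ?ltr0n.
have bref K : bounded_rv (fun w => \sum_(1 <= i < N.+1) b i w * refined_step K i w).
  apply: bounded_rv_sum_nat => i i0; apply: bounded_rvM; first by case: (hb i).
  exact: bounded_refined_step.
have btr : bounded_rv (fun w => \sum_(1 <= i < N.+1) b i w * trunc_step i w).
  apply: bounded_rv_sum_nat => i i0; apply: bounded_rvM; first by case: (hb i).
  exact: bounded_trunc_step.
have brest K i : (0 < i)%N ->
    bounded_rv (fun w => `|refined_step K i w - trunc_step i w| * `|b i w|).
  move=> i0; apply: bounded_rvM; apply: bounded_rv_norm; last by case: (hb i).
  by apply: bounded_rvB; [exact: bounded_refined_step|exact: bounded_trunc_step].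
have brests K : bounded_rv (fun w =>
    \sum_(1 <= i < N.+1) `|refined_step K i w - trunc_step i w| * `|b i w|).
  by apply: bounded_rv_sum_nat => i; exact: brest.
apply: (@fatou_le _ _ _ P (fun K w => `|\sum_(1 <= i < N.+1) b i w * refined_step K i w|)) => //.
- by move=> K; apply: bounded_rv_measurable; exact: bounded_rv_norm.
- apply: measurableT_comp => //; apply: measurable_sum_nat => i i0.
  apply: measurable_funM; last exact: measurable_step.
  by case: (hb i) => /bounded_rv_measurable.
- apply: aeW => w; apply: cvg_norm; apply: cvg_sum_nat => i i0.
  by apply: cvgMr; apply: sin_trunc_cvg; exact: cutoff_gt0.
move=> K; apply: le_integral_bounded; first exact: bounded_rv_norm.
pose q w := 2^-1 * (B^-1 * (\sum_(1 <= i < N.+1) b i w * trunc_step i w) ^+ 2 + B).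
have bA2 := bounded_rvX 2 btr.
have bBA2 : bounded_rv (fun w => B^-1 * (\sum_(1 <= i < N.+1) b i w * trunc_step i w) ^+ 2).
  by apply: bounded_rvM => //; exact: bounded_rv_cst.
have bBA2B := bounded_rvD bBA2 (bounded_rv_cst (T := T) B).
have bq : bounded_rv q by apply: bounded_rvM => //; exact: bounded_rv_cst.
apply: (@le_trans _ _ (\int[P]_w (q w +
    \sum_(1 <= i < N.+1) `|refined_step K i w - trunc_step i w| * `|b i w|))).
  apply: le_expect; [exact: bounded_rv_norm|exact: bounded_rvD|move=> w].
  rewrite (_ : \sum_(1 <= i < N.+1) b i w * refined_step K i w =
    \sum_(1 <= i < N.+1) b i w * trunc_step i w +
    \sum_(1 <= i < N.+1) (refined_step K i w - trunc_step i w) * b i w); last first.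
    by rewrite -big_split; apply: eq_bigr => i _ /=; ring.
  apply: le_trans (ler_normD _ _) _; apply: lerD; first exact: norm_le_sqr.
  apply: le_trans (ler_norm_sum _ _ _) _.
  by apply: ler_sum => i _; rewrite normrM.
rewrite expectD// (expectZ P _ bBA2B) (expectD P bBA2 (bounded_rv_cst B)) (expectZ P _ bA2) expect_cst.
have e1 : \int[P]_w ((\sum_(1 <= i < N.+1) b i w * trunc_step i w) ^+ 2) <=
    G ^+ 2 * B ^+ 2 * 2 * (1 + (2 * decay)^-1).
  apply: le_trans (expect_combo_sqr N.+1 (ltn0Sn 0) hb bG) _.
  apply: (@le_trans _ _ (\sum_(1 <= i < N.+1) G ^+ 2 * B ^+ 2 * 2 * i%:R `^ (- (1 + 2 * decay)))).
    rewrite !big_nat le_eqVlt; apply/orP; left; apply/eqP/eq_bigr => i /andP[i0 _].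
    by rewrite -trunc_weightE//; ring.
  rewrite -mulr_sumr ler_wpM2l ?mulr_ge0 ?(ltW G0) ?(ltW B0)//.
  by apply: riemann_sum_le1; rewrite mulr_gt0.
have e2 : \int[P]_w (\sum_(1 <= i < N.+1) `|refined_step K i w - trunc_step i w| * `|b i w|)
    <= G * B * tail_const * (1 + decay^-1).
  have -> : (fun w => \sum_(1 <= i < N.+1) `|refined_step K i w - trunc_step i w| * `|b i w|) =
      (fun w => \sum_(i <- index_iota 1 N.+1 | i \in index_iota 1 N.+1)
        `|refined_step K i w - trunc_step i w| * `|b i w|).
    by apply/funext => w; rewrite big_seq.
  rewrite expect_sum; last by move=> i; rewrite mem_index_iota => /andP[i0 _]; exact: brest.
  apply: (@le_trans _ _ (\sum_(1 <= i < N.+1) G * B * tail_const * i%:R `^ (- (1 + decay)))).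
    rewrite [leRHS]big_seq; apply: ler_sum => i; rewrite mem_index_iota => /andP[i0 _].
    apply: le_trans (expect_refined_dist _ i0 hb (g0 i i0) (bG i i0)) _.
    by rewrite /g -rest_weightE// le_eqVlt; apply/orP; left; apply/eqP; ring.
  rewrite -mulr_sumr ler_wpM2l ?mulr_ge0 ?tail_const_ge0 ?(ltW B0) ?(ltW G0)//.
  exact: riemann_sum_le1.
apply: le_trans (lerD (ler_wpM2l _ (lerD (ler_wpM2l _ e1) (lexx B))) e2) _.
- by rewrite invr_ge0.
- by rewrite invr_ge0 ltW.
rewrite le_eqVlt; apply/orP; left; apply/eqP; rewrite /l1_const.
by field; rewrite !gt_eqF.
Qed.

End RandomCombinations.

Arguments step {R disp T d xi} j i w.
Arguments cutoff {R} alpha i.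
Arguments trunc_step {R disp T d} alpha {xi} j i w.
Arguments refined_step {R disp T d} alpha {xi} j K i w.
Arguments decay {R} alpha p.
Arguments tail_const {R} alpha.
Arguments l1_const {R} alpha p G.
Arguments tree_coef {R disp T d xi U eps} b.

(** * Coordinatewise limits of row vectors *)
Section RowVectorLimits.
Context {R : realType} {d : nat}.
Implicit Types (u : nat -> 'rV[R]_d) (l : 'rV[R]_d).

Lemma cvg_rV u l : (forall j, u n 0 j @[n --> \oo] --> l 0 j) -> u n @[n --> \oo] --> l.
Proof.
move=> ul; apply/cvg_ballP => e e0.
have : \forall n \near \oo, forall j : 'I_d, ball (l 0 j) e (u n 0 j).
  by apply: filter_forall => j; exact: (cvg_ball (ul j)).
by apply: filterS => n H; split => // i j; rewrite (ord1 i).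
Qed.

Lemma cvg_coord u l j : u n @[n --> \oo] --> l -> u n 0 j @[n --> \oo] --> l 0 j.
Proof. move=> ul; apply: (@cvg_comp _ _ _ u (fun v : 'rV[R]_d => v 0 j) _ _ _ ul).
exact: coord_continuous. Qed.

Lemma cvgn_rVP u : cvgn u <-> forall j, cvgn (fun n => u n 0 j).
Proof.
split=> [/cvg_ex[l ul] j|cu]; first by apply/cvg_ex; exists (l 0 j); exact: cvg_coord.
apply/cvg_ex; exists (\row_j limn (fun n => u n 0 j)); apply: cvg_rV => j.
by rewrite mxE; exact: cu.
Qed.

Lemma limn_coord u j : cvgn u -> (limn u) 0 j = limn (fun n => u n 0 j).
Proof. by move=> cu; apply/esym/cvg_lim => //; exact: cvg_coord. Qed.

(** Existence of the vector limit depends on all coordinates, hence the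
    intersection of the convergence sets. *)
Lemma measurable_limn_coord {disp : measure_display} {T : measurableType disp}
    (u : T -> nat -> 'rV[R]_d) (j : 'I_d) :
  (forall n i, measurable_fun setT (fun w => u w n 0 i)) ->
  measurable_fun setT (fun w => (limn (u w)) 0 j).
Proof.
move=> mu; pose D := [set w | cvgn (u w)].
have mD : measurable D.
  rewrite (_ : D = \bigcap_(i : 'I_d) [set w | cvgn (fun n => u w n 0 i)]).
    by apply: fin_bigcap_measurable => // i _; exact: (measurable_cvgn (u := fun n w => u w n 0 i)).
  apply/seteqP; split => w /=; first by move=> /cvgn_rVP cu i _; exact: cu.
  by move=> cu; apply/cvgn_rVP => i; exact: cu.
rewrite -(setUv D); apply/measurable_funU => //; first exact: measurableC.
split.
  apply: (eq_measurable_fun (fun w => limn (fun n => u w n 0 j))).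
    by move=> w /set_mem Dw; rewrite limn_coord.
  by apply: measurable_funTS; exact: (measurable_limn (u := fun n w => u w n 0 j)).
apply: (eq_measurable_fun (fun=> (point : 'rV[R]_d) 0 j)); last exact: measurable_cst.
move=> w /set_mem Dw; rewrite (_ : limn (u w) = point)//; apply/getPN => l ul.
by apply: Dw; apply/cvg_ex; exists l.
Qed.

End RowVectorLimits.

(** * The limiting series *)
Section ClusterSeries.
Context {R : realType} {disp : measure_display} {T : measurableType disp}.
Context {P : probability T R} {d : nat} {alpha p : R}.
Context {xi : nat -> T -> 'rV[R]_d} {U : nat -> T -> nat}.
Context {eps : nat -> T -> bool} {Y : nat -> T -> 'rV[R]_d}.
Hypothesis halpha : 0 < alpha <= 2.
Hypothesis hp : 0 < p < 1.
Hypothesis halphap : 1 < alpha * p.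
Hypothesis hS : shark_random_swim P alpha p xi U eps Y.
Implicit Types (k m n i N : nat).

Local Notation th := (decay alpha p).
Local Notation mg := (size_mg p U eps).
Local Notation mgl := (mg_lim p U eps).

Let th_gt0 : 0 < th := decay_gt0 halpha halphap.
Let th_le : 2 * th <= p := decay_le halpha.

Definition mg_const : R := Num.sqrt (3 + 2 / th).

Lemma mg_const_gt0 : 0 < mg_const.
Proof. by rewrite sqrtr_gt0 ltr_pwDl// divr_ge0// ltW. Qed.

Definition mg_rate m : R := m.+1%:R `^ (- (th / 2)).

Lemma mg_rate_gt0 m : 0 < mg_rate m.
Proof. exact: natr_powR_gt0. Qed.

Lemma expect_mg_dist i m n : (0 < i)%N -> (m <= n)%N ->
  \int[P]_w ((mg i n w - mg i m w) ^+ 2) <=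
    (mg_const * (i%:R `^ (th - p) * mg_rate m)) ^+ 2.
Proof.
move=> i0 mn; apply: le_trans (expect_size_mg_unif hp hS th_gt0 th_le i0 mn) _.
by rewrite [leRHS]exprMn sqr_sqrtr// addr_ge0// divr_ge0// ltW.
Qed.

Lemma mg0 i w : (0 < i)%N -> mg i 0 w = 0.
Proof. by move=> i0; rewrite /size_mg (root_count_eq0 hS)// mul0r. Qed.

Lemma expect_mg_sqr i n : (0 < i)%N ->
  \int[P]_w (mg i n w ^+ 2) <= (mg_const * (i%:R `^ (th - p) * 1)) ^+ 2.
Proof.
move=> i0; have := expect_mg_dist i0 (leq0n n); rewrite /mg_rate powR1.
by under eq_Rintegral do rewrite mg0// subr0.
Qed.

Lemma tree_index_sub n : tree_index n `<=` tree_indices.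
Proof. by case=> [[i|k]|k] //= /andP[]. Qed.

Lemma tree_coef_mg n : tree_coef (xi := xi) (U := U) (eps := eps) (fun i => mg i n).
Proof.
move=> i; split; first exact: (bounded_size_mg hS).
by apply: (measurable_size_mg_sub hp hS); exact: tree_index_sub.
Qed.

Lemma tree_coef_mgB m n :
  tree_coef (xi := xi) (U := U) (eps := eps) (fun i w => mg i m w - mg i n w).
Proof.
move=> i; have [bm mm] := tree_coef_mg m i; have [bn mn] := tree_coef_mg n i.
split; first exact: bounded_rvB.
exact: (@measurable_funB _ (sub_sigma _)).
Qed.

Lemma ae_cvg_mg : {ae P, forall w, forall i, (0 < i)%N -> mg i n w @[n --> \oo] --> mgl i w}.
Proof.
apply/ae_foralln => i; case: i => [|i]; first exact: aeW.
by apply: filterS (ae_cvg_size_mg hp hS (ltn0Sn i)) => w.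
Qed.

Section Coordinate.
Variable j : 'I_d.

Local Notation x := (step (xi := xi) j).
Local Notation s := (trunc_step alpha (xi := xi) j).

(** The bound of [expect_combo_sqr] passes from the weights at a finite time to
    their limits. *)
Lemma integral_trunc_block a N : (0 < a)%N ->
  (\int[P]_w ((\sum_(a <= i < N) mgl i w * s i w) ^+ 2)%:E <=
   (\sum_(a <= i < N) mg_const ^+ 2 * 2 * i%:R `^ (- (1 + 2 * th)))%:E)%E.
Proof.
move=> a0.
have bpart n : bounded_rv (fun w => \sum_(a <= i < N) mg i n w * s i w).
  apply: bounded_rv_sum_nat => i ai; apply: bounded_rvM; first exact: (bounded_size_mg hS).
  by apply: (bounded_trunc_step hS); exact: leq_trans ai.
apply: (@fatou_le _ _ _ P (fun n w => (\sum_(a <= i < N) mg i n w * s i w) ^+ 2)).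
- by move=> n; apply: bounded_rv_measurable; exact: bounded_rvX.
- by move=> n w; exact: sqr_ge0.
- apply: measurable_funX; apply: measurable_sum_nat => i ai; apply: measurable_funM.
    exact: (measurable_mg_lim hS).
  by apply: bounded_rv_measurable; apply: (bounded_trunc_step hS); exact: leq_trans ai.
- by move=> w; exact: sqr_ge0.
- apply: filterS ae_cvg_mg => w mgw; rewrite expr2; under eq_fun do rewrite expr2.
  have H : \sum_(a <= i < N) mg i n w * s i w @[n --> \oo] --> \sum_(a <= i < N) mgl i w * s i w.
  apply: cvg_sum_nat => i ai; apply: cvgMl; apply: mgw; exact: leq_trans ai.
  exact: cvgM.
move=> n; apply: le_integral_bounded; first exact: bounded_rvX.
pose g i : R := mg_const * (i%:R `^ (th - p) * 1).
have mgg i : (0 < i)%N -> \int[P]_w (mg i n w ^+ 2) <= g i ^+ 2 by exact: expect_mg_sqr.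
apply: le_trans (expect_combo_sqr halpha hS j N a0 (tree_coef_mg n) mgg) _.
rewrite !big_nat le_eqVlt; apply/orP; left; apply/eqP/eq_bigr => i /andP[ai _].
by rewrite /g -(trunc_weightE halpha) ?(leq_trans a0 ai)//; ring.
Qed.

Lemma integral_rest i : (0 < i)%N ->
  (\int[P]_w (`|mgl i w| * `|x i w - s i w|)%:E <=
   (mg_const * tail_const alpha * i%:R `^ (- (1 + th)))%:E)%E.
Proof.
move=> i0; have bmg n := bounded_size_mg hS i n.
have bd n := bounded_rvB (bounded_refined_step (alpha := alpha) hS j n i0) (bounded_trunc_step hS j i0).
have mx : measurable_fun setT (x i) by exact: (measurable_step hS).
have ms : measurable_fun setT (s i) by apply: bounded_rv_measurable; exact: (bounded_trunc_step hS).
(* both limits, in the tree and in the truncation level, are taken together *)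
apply: (@fatou_le _ _ _ P (fun n w => `|mg i n w| * `|refined_step alpha j n i w - s i w|)).
- by move=> n; apply: bounded_rv_measurable; apply: bounded_rvM; apply: bounded_rv_norm; [exact: bmg|exact: bd].
- by move=> n w; rewrite mulr_ge0.
- apply: measurable_funM; apply: measurableT_comp => //; last exact: measurable_funB.
  exact: (measurable_mg_lim hS).
- by move=> w; rewrite mulr_ge0.
- apply: filterS ae_cvg_mg => w mgw; apply: cvgM; first by apply: cvg_norm; exact: mgw.
  apply: cvg_norm; apply: cvgB; last exact: cvg_cst.
  by apply: sin_trunc_cvg; exact: cutoff_gt0.
move=> n; apply: le_integral_bounded; first by apply: bounded_rvM; apply: bounded_rv_norm; [exact: bmg|exact: bd].
pose g k : R := mg_const * (k%:R `^ (th - p) * 1).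
have g0 : 0 < g i by rewrite !mulr_gt0 ?mg_const_gt0 ?powR_gt0 ?ltr0n.
have mgg : \int[P]_w (mg i n w ^+ 2) <= g i ^+ 2 by exact: expect_mg_sqr.
have := expect_refined_dist halpha hp halphap hS j n i0 (tree_coef_mg n) g0 mgg.
rewrite /g -(rest_weightE halpha)// => H.
apply: le_trans (le_trans H _); rewrite le_eqVlt; apply/orP; left; apply/eqP.
  by apply: eq_Rintegral => w _; rewrite mulrC.
by ring.
Qed.

(** Coordinate [j] of the partial sums of the limiting series, up to the factor
    [kappa] between [M_i] and [X_i]. *)
Definition coord_series N w : R := \sum_(1 <= i < N.+1) mgl i w * x i w.

(** The truncated part converges by chaining, and the remainders are absolutely
    summable. *)
Lemma ae_cvg_coord_series : {ae P, forall w, cvgn (coord_series ^~ w)}.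
Proof.
pose S N w := \sum_(1 <= i < N.+1) mgl i w * s i w.
have mS N : measurable_fun setT (S N).
  apply: measurable_sum_nat => i i0; apply: measurable_funM.
    exact: (measurable_mg_lim hS).
  by apply: bounded_rv_measurable; exact: (bounded_trunc_step hS).
have cS : {ae P, forall w, cvgn (S ^~ w)}.
  apply: (@chaining_ae_cvg _ _ _ P S (mg_const ^+ 2 * 2) (2 * th)) => //.
  - by rewrite mulr_gt0.
  - by rewrite mulr_ge0 ?sqr_ge0.
  move=> m n mn; apply: le_trans (_ : (\int[P]_w ((\sum_(m.+1 <= i < n.+1) mgl i w * s i w) ^+ 2)%:E <= _)%E).
    rewrite le_eqVlt; apply/orP; left; apply/eqP/eq_integral => w _; congr (_ ^+ 2)%:E.
    by rewrite /S (@big_cat_nat _ _ _ m.+1 1 n.+1)//= addrAC subrr add0r.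
  by apply: le_trans (integral_trunc_block _ _) _; rewrite // big_add1.
pose Rst k w := `|mgl k.+1 w| * `|x k.+1 w - s k.+1 w|.
have cR : {ae P, forall w, cvgn (series (Rst ^~ w))}.
  apply: (@ae_cvg_series _ _ _ P Rst (fun k => mg_const * tail_const alpha * k.+1%:R `^ (- (1 + th)))).
  - move=> k; apply: measurable_funM; apply: measurableT_comp => //.
      exact: (measurable_mg_lim hS).
    apply: measurable_funB; first exact: (measurable_step hS).
    by apply: bounded_rv_measurable; exact: (bounded_trunc_step hS).
  - by move=> k w; rewrite mulr_ge0.
  - by move=> k; exact: integral_rest.
  apply: is_cvg_seriesZ; apply: nondecreasing_is_cvgn.
    by apply: nondecreasing_series => k _ _; exact: powR_ge0.
  by exists (1 + th^-1) => _ [n _ <-]; exact: riemann_sum_le.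
apply: filterS2 cS cR => w cSw cRw.
have -> : coord_series ^~ w = (fun N => S N w + series (fun k => mgl k.+1 w * (x k.+1 w - s k.+1 w)) N).
  apply/funext => N; rewrite /coord_series /S /series/= big_add1/= [X in X + _]big_add1 -big_split/=.
  by apply: eq_bigr => i _; ring.
apply: is_cvgD => //; apply: normed_cvg; move: cRw.
rewrite (_ : series (Rst ^~ w) = [normed series (fun k => mgl k.+1 w * (x k.+1 w - s k.+1 w))])//.
by apply/funext => N; apply: eq_bigr => i _; exact/esym/normrM.
Qed.

Definition coord_limit w : R := limn (coord_series ^~ w).

Lemma measurable_coord_series N : measurable_fun setT (coord_series N).
Proof.
apply: measurable_sum_nat => i i0; apply: measurable_funM.
  exact: (measurable_mg_lim hS).
exact: (measurable_step hS).
Qed.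

Lemma measurable_coord_limit : measurable_fun setT coord_limit.
Proof. exact: measurable_limn measurable_coord_series. Qed.

Local Notation C := (l1_const alpha p mg_const).

(** The bound of [integral_combo_le] for [M_i(m) - M_i(n)], as [n] tends to
    infinity. *)
Lemma mg_dist_limit m N :
  (\int[P]_w (`|\sum_(1 <= i < N.+1) (mg i m w - mgl i w) * x i w|)%:E <=
   (C * mg_rate m)%:E)%E.
Proof.
apply: (@fatou_le _ _ _ P (fun n w =>
    `|\sum_(1 <= i < N.+1) (mg i m w - mg i (n + m)%N w) * x i w|)) => //.
- move=> n; apply: measurableT_comp => //; apply: measurable_sum_nat => i i0.
  apply: measurable_funM; last exact: (measurable_step hS).
  by apply: bounded_rv_measurable; apply: bounded_rvB; exact: (bounded_size_mg hS).
- apply: measurableT_comp => //; apply: measurable_sum_nat => i i0.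
  apply: measurable_funM; last exact: (measurable_step hS).
  apply: measurable_funB; last exact: (measurable_mg_lim hS).
  by apply: bounded_rv_measurable; exact: (bounded_size_mg hS).
- apply: filterS ae_cvg_mg => w mgw; apply: cvg_norm; apply: cvg_sum_nat => i i0.
  apply: cvgMl; apply: cvgB; first exact: cvg_cst.
  by rewrite (cvg_shiftn m (fun n => mg i n w)); exact: mgw.
move=> n; apply: (@integral_combo_le _ _ _ _ _ _ _ _ _ _ _ halpha hp halphap hS j (fun i w => mg i m w - mg i (n + m)%N w) mg_const (mg_rate m) N mg_const_gt0 (mg_rate_gt0 m)).
  exact: tree_coef_mgB.
move=> i i0; have := expect_mg_dist i0 (leq_addl n m); apply: le_trans.
by rewrite le_eqVlt; apply/orP; left; apply/eqP/eq_Rintegral => w _; rewrite -sqrrN opprB.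
Qed.

(** Clusters with [i > m] are empty at time [m], so the finite sum is compared
    with arbitrarily long partial sums of the series. *)
Lemma coord_limit_dist m :
  (\int[P]_w (`|\sum_(1 <= i < m.+1) mg i m w * x i w - coord_limit w|)%:E <=
   (C * mg_rate m)%:E)%E.
Proof.
have mmg : measurable_fun setT (fun w => \sum_(1 <= i < m.+1) mg i m w * x i w).
  apply: measurable_sum_nat => i i0; apply: measurable_funM; last exact: (measurable_step hS).
  by apply: bounded_rv_measurable; exact: (bounded_size_mg hS).
apply: (@fatou_le _ _ _ P (fun n w =>
    `|\sum_(1 <= i < m.+1) mg i m w * x i w - coord_series (n + m) w|)) => //.
- move=> n; apply: measurableT_comp => //; apply: measurable_funB => //.
  exact: measurable_coord_series.
- apply: measurableT_comp => //; apply: measurable_funB => //.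
  exact: measurable_coord_limit.
- apply: filterS ae_cvg_coord_series => w cw; apply: cvg_norm; apply: cvgB; first exact: cvg_cst.
  by rewrite (cvg_shiftn m (coord_series ^~ w)).
move=> n; apply: le_trans (mg_dist_limit m (n + m)).
rewrite le_eqVlt; apply/orP; left; apply/eqP/eq_integral => w _; congr (`|_|)%:E.
rewrite /coord_series; under [RHS]eq_bigr do rewrite mulrBl.
rewrite sumrB; congr (_ - _).
rewrite [RHS](@big_cat_nat _ _ _ m.+1)//= ?ltnS ?leq_addl// [X in _ + X]big1_seq ?addr0// => i.
rewrite mem_index_iota => /andP[_ /andP[mi _]].
by rewrite /size_mg (root_count_eq0 hS)// !mul0r.
Qed.

(** The previous bound at [m = 0], where the finite sum is empty. *)
Lemma integral_coord_limit : (\int[P]_w (`|coord_limit w|)%:E <= C%:E)%E.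
Proof.
have := coord_limit_dist 0; rewrite /mg_rate powR1 mulr1; apply: le_trans.
rewrite le_eqVlt; apply/orP; left; apply/eqP/eq_integral => w _.
by rewrite big_geq// sub0r normrN.
Qed.

End Coordinate.
End ClusterSeries.

Arguments mg_const {R} alpha p.
Arguments mg_rate {R} alpha p m.
Arguments coord_series {R disp T d} p xi U eps j N w.
Arguments coord_limit {R disp T d} p xi U eps j w.

(** * Rescaled time *)
Section ScaledTimes.
Context {R : realType}.
Implicit Types (t p s kap : R) (n m : nat).

Lemma cvg_invr_nat : (n%:R : R)^-1 @[n --> \oo] --> (0 : R).
Proof.
by rewrite -(cvg_shiftS (fun n => (n%:R : R)^-1)); exact: cvg_harmonic.
Qed.

Lemma cvg_natr_powRN s : 0 < s -> n.+1%:R `^ (- s) @[n --> \oo] --> (0 : R).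
Proof.
move=> s0; under eq_fun do rewrite powRN invr_powR//.
have /cvg_at_rightP := powR_cvg0 s0; apply; split=> [n|]; last exact: cvg_harmonic.
by rewrite invr_gt0.
Qed.

Lemma cvg_powR (u : nat -> R) t s : 0 < t -> u n @[n --> \oo] --> t ->
  u n `^ s @[n --> \oo] --> t `^ s.
Proof.
move=> t0 ut; rewrite {2}/powR gt_eqF//.
have : expR (s * ln (u n)) @[n --> \oo] --> expR (s * ln t).
  apply: (@cvg_comp _ _ _ (fun n => s * ln (u n)) expR _ (nbhs (s * ln t))); last exact: continuous_expR.
  apply: cvgMr; apply: (@cvg_comp _ _ _ u (@ln R) _ (nbhs t)) => //.
  exact: continuous_ln.
apply: cvg_trans; apply: near_eq_cvg.
have : \forall n \near \oo, 0 < u n by exact: cvgr_gt ut _ t0.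
by apply: filterS => n un0; rewrite /powR gt_eqF.
Qed.

Lemma cvg_truncn_ratio t : 0 <= t ->
  (Num.truncn (n%:R * t))%:R / n%:R @[n --> \oo] --> t.
Proof.
move=> t0; apply: (@squeeze_cvgr _ _ _ _ (fun n : nat => t - n%:R^-1) (fun=> t)).
- near=> n; have n0 : 0 < n%:R :> R by rewrite ltr0n; near: n; exact: nbhs_infty_gt.
  have /andP[ml mu] := truncn_itv (mulr_ge0 (ltW n0) t0).
  rewrite ler_pdivlMr// mulrBl mulVf ?gt_eqF// ler_pdivrMr// mulrC ml andbT.
  by rewrite lerBlDr -natr1 in mu *; exact: ltW.
- by rewrite -[X in _ --> X]subr0; apply: cvgB; [exact: cvg_cst|exact: cvg_invr_nat].
- exact: cvg_cst.
Unshelve. all: by end_near. Qed.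

Lemma cvg_truncn_infty t : 0 < t -> Num.truncn (n%:R * t) @[n --> \oo] --> \oo.
Proof.
move=> t0; apply/cvgnyPge => A; exists (Num.truncn (A.+1%:R / t)).+1 => // n /= An.
rewrite leqNgt truncn_lt_nat ?mulr_ge0 ?(ltW t0)// -leNgt.
rewrite -ler_pdivrMr//; apply: le_trans (_ : A.+1%:R / t <= _).
  by rewrite ler_pM2r ?invr_gt0// ler_nat.
by apply/ltW/(lt_le_trans (truncnS_gt _)); rewrite ler_nat.
Qed.

(** The factor between the normalised swim at time [floor (n t)] and the
    combination of the [M_i] at that time. *)
Definition scaled_growth p t n : R :=
  growth p (Num.truncn (n%:R * t)) / n%:R `^ p.

Lemma cvg_scaled_growth p t kap : 0 < p < 1 -> 0 <= t ->
    growth_ratio p n @[n --> \oo] --> kap ->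
  scaled_growth p t n @[n --> \oo] --> t `^ p * kap.
Proof.
move=> hp t0 grk; have /andP[p0 p1] := hp.
move: t0; rewrite le_eqVlt => /predU1P[<-|t0].
  (* at [t = 0] the time is constantly [0] and the normalisation alone tends to zero *)
  rewrite powR0 ?gt_eqF// mul0r -cvg_shiftS.
  apply: cvg_trans (cvg_natr_powRN p0); apply: near_eq_cvg; apply: nearW => n.
  by rewrite /= /scaled_growth mulr0 truncn0 /growth big_geq// mul1r powRN.
have cm := cvg_truncn_infty t0.
have : ((Num.truncn (n%:R * t))%:R / n%:R) `^ p * growth_ratio p (Num.truncn (n%:R * t))
    @[n --> \oo] --> t `^ p * kap.
  apply: cvgM; first by apply: cvg_powR => //; exact/cvg_truncn_ratio/ltW.
  exact: (cvg_comp _ _ cm grk).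
apply: cvg_trans; apply: near_eq_cvg; near=> n.
have m0 : (0 < Num.truncn (n%:R * t))%N by near: n; move/cvgnyPgt: cm; exact.
rewrite /scaled_growth /growth_ratio powRM ?invr_ge0// -invr_powR//.
by rewrite mulrC mulrA divfK// gt_eqF// powR_gt0// ltr0n.
Unshelve. all: by end_near. Qed.

Lemma cvg_scaled_growth_rate p t kap s : 0 < p < 1 -> 0 <= t -> 0 < s ->
    growth_ratio p n @[n --> \oo] --> kap ->
  scaled_growth p t n * (Num.truncn (n%:R * t)).+1%:R `^ (- s) @[n --> \oo] --> (0 : R).
Proof.
move=> hp t0 s0 grk; have cg := cvg_scaled_growth hp t0 grk.
move: t0; rewrite le_eqVlt => /predU1P[t0|t0].
  rewrite -t0 in cg *; under eq_fun do rewrite mulr0 truncn0 powR1 mulr1.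
  by rewrite powR0 ?mul0r// in cg; case/andP: hp => p0 _; rewrite gt_eqF.
rewrite -(mulr0 (t `^ p * kap)); apply: cvgM => //.
exact: (cvg_comp _ _ (cvg_truncn_infty t0) (cvg_natr_powRN s0)).
Qed.

End ScaledTimes.

(** * From first moments to convergence in probability *)
Section ConvergenceInProbability.
Context {R : realType} {disp : measure_display} {T : measurableType disp}.
Variable P : probability T R.

Lemma euclid_norm_le_sum d (v : 'rV[R]_d) : euclid_norm v <= \sum_(j < d) `|v 0 j|.
Proof.
have S0 : 0 <= \sum_(j < d) `|v 0 j| by exact: sumr_ge0.
rewrite -[leRHS]ger0_norm// -sqrtr_sqr ler_sqrt ?sqr_ge0//.
rewrite expr2 mulr_sumr; apply: ler_sum => j _.
rewrite -expr2 -[leLHS]real_normK ?num_real// expr2 ler_wpM2r//.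
by rewrite (bigD1 j)//= lerDl sumr_ge0.
Qed.

Lemma measurable_euclid_norm_gt d (X : T -> 'rV[R]_d) (e : R) :
  (forall j, measurable_fun setT (fun w => X w 0 j)) -> 0 < e ->
  measurable [set w | e < euclid_norm (X w)].
Proof.
move=> mX e0; rewrite (_ : [set _ | _] = (fun w => inner (X w) (X w)) @^-1` `]e ^+ 2, +oo[).
  rewrite -[X in measurable X]setTI; apply: (_ : measurable_fun setT _) => //.
  by apply: measurable_sum => j; exact: measurable_funM.
have sqrtE (s : R) : (e < Num.sqrt s) = (e ^+ 2 < s).
  by rewrite -{1}(ger0_norm (ltW e0)) -sqrtr_sqr ltNge ler_sqrt ?sqr_ge0// -ltNge.
by apply/seteqP; split => w /=; rewrite in_itv/= andbT /euclid_norm sqrtE.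
Qed.

(** Markov's inequality for the sum of the absolute values of the coordinates,
    which dominates the Euclidean norm. *)
Lemma cvg_in_probability_l1 d (V : nat -> T -> 'rV[R]_d) (W : T -> 'rV[R]_d) (b : nat -> R) :
    (forall n j, measurable_fun setT (fun w => V n w 0 j)) ->
    (forall j, measurable_fun setT (fun w => W w 0 j)) ->
    (forall n j, \int[P]_w (`|V n w 0 j - W w 0 j|)%:E <= (b n)%:E)%E ->
    b n @[n --> \oo] --> 0 ->
  cvg_in_probability P V W.
Proof.
move=> mV mW Vb b0 e e0.
have mD n j : measurable_fun setT (fun w => (V n w - W w) 0 j).
  by under eq_fun do rewrite !mxE; exact: measurable_funB.
have mN n j : measurable_fun setT (fun w => (`|(V n w - W w) 0 j|)%:E).
  by apply/measurable_EFinP; apply: measurableT_comp.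
have le_b n : (P [set w | (e < euclid_norm (V n w - W w))%R] <= (e^-1 * (b n *+ d))%:E)%E.
  have mA := measurable_euclid_norm_gt (mD n) e0; set A := [set w | _] in mA *.
  rewrite EFinM lee_pdivlMl// -(integral_cst P mA).
  apply: (@le_trans _ _ (\int[P]_(w in A) (\sum_(j < d) (`|(V n w - W w) 0 j|)%:E))%E).
    apply: ge0_le_integral => //.
    - by move=> w _ /=; rewrite lee_fin ltW.
    - by apply: measurable_funTS; exact: emeasurable_sum.
    move=> w /= Aw; rewrite sumEFin lee_fin.
    exact: le_trans (ltW Aw) (euclid_norm_le_sum _).
  apply: (@le_trans _ _ (\int[P]_w (\sum_(j < d) (`|(V n w - W w) 0 j|)%:E))%E).
    apply: ge0_subset_integral => //; first exact: emeasurable_sum.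
    by move=> w _; apply: sume_ge0 => j _; rewrite lee_fin.
  rewrite ge0_integral_sum//.
  rewrite (_ : b n *+ d = \sum_(j < d) b n); last by rewrite sumr_const card_ord.
  rewrite -sumEFin; apply: lee_sum => j _.
  by under eq_integral do rewrite !mxE; exact: Vb.
apply: (@squeeze_cvge _ _ _ _ (fun=> 0%E) _ (fun n => (e^-1 * (b n *+ d))%:E)).
- by apply: nearW => n; rewrite le_b andbT.
- exact: cvg_cst.
apply: cvg_EFin; first exact: nearW.
under eq_fun do rewrite -mulr_natr.
by rewrite -(mulr0 e^-1) -(mul0r d%:R); apply: cvgMr; exact: cvgMl.
Qed.

End ConvergenceInProbability.

(** * The limit of the swim *)
Section SwimLimit.
Context {R : realType} {disp : measure_display} {T : measurableType disp}.
Context {P : probability T R} {d : nat} {alpha p : R}.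
Context {xi : nat -> T -> 'rV[R]_d} {U : nat -> T -> nat}.
Context {eps : nat -> T -> bool} {Y : nat -> T -> 'rV[R]_d}.
Hypothesis halpha : 0 < alpha <= 2.
Hypothesis hp : 0 < p < 1.
Hypothesis halphap : 1 < alpha * p.
Hypothesis hS : shark_random_swim P alpha p xi U eps Y.
Implicit Types (k m n i : nat) (j : 'I_d).

Local Notation root k w := (cluster_root (U ^~ w) (eps ^~ w) k).
Local Notation mg := (size_mg p U eps).
Local Notation mgl := (mg_lim p U eps).
Local Notation x := (step (xi := xi)).
Local Notation kap := (limn (growth_ratio p)).

Let U_range w k : (2 <= k)%N -> (1 <= U k w <= k.-1)%N.
Proof. by move=> k2; exact: (srs_U_range hS). Qed.

(** A node copies its parent along a kept edge, and so all nodes of a cluster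
    carry the step of its root. *)
Lemma step_root k w : (0 < k)%N -> Y k w = xi (root k w) w.
Proof.
elim/ltn_ind: k => -[//|[|k]] IH _; first exact: (srs_Y1 hS).
rewrite (srs_Yk hS)// (cluster_rootE _ (U_range w))/=; case: ifP => // _.
have /andP[U1 Uk] : (1 <= U k.+2 w <= k.+1)%N by exact: U_range.
exact: IH.
Qed.

(** The swim regrouped by clusters. *)
Lemma swim_coord m j w :
  swim Y m w 0 j = growth p m * \sum_(1 <= i < m.+1) mg i m w * x j i w.
Proof.
rewrite /swim (_ : \sum_(1 <= i < m.+1) Y i w = \sum_(1 <= k < m.+1) xi (root k w) w); last first.
  by rewrite !big_nat; apply: eq_bigr => k /andP[k0 _]; exact: step_root.
rewrite (sum_by_root _ (U_range w) m (xi ^~ w)) summxE mulr_sumr; apply: eq_bigr => i _.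
rewrite mulmxnE /size_mg /root_count /step -mulr_natr.
by field; rewrite gt_eqF// growth_gt0.
Qed.

Lemma cluster_lim_mg w i : (0 < i)%N -> mg i n w @[n --> \oo] --> mgl i w ->
  n%:R `^ (- p) * (cluster_size U eps n i w)%:R @[n --> \oo] --> kap * mgl i w.
Proof.
move=> i0 mgw; apply: cvg_trans (cvgM (is_cvg_growth_ratio hp) mgw).
apply: near_eq_cvg; apply: nearW => n.
rewrite /cluster_size (card_cluster _ (U_range w))// powRN /growth_ratio /size_mg /root_count.
by rewrite /= mulrC mulrA divfK ?gt_eqF ?growth_gt0// mulrC.
Qed.

Lemma ae_cluster_lim : {ae P, forall w, forall i, (0 < i)%N ->
  cluster_lim p U eps i w = kap * mgl i w}.
Proof.
apply: filterS (ae_cvg_mg hp hS) => w mgw i i0; apply/cvg_lim => //.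
by apply: cluster_lim_mg => //; exact: mgw.
Qed.

Lemma measurable_cluster_lim i : (0 < i)%N -> measurable_fun setT (cluster_lim p U eps i).
Proof.
move=> i0; apply: measurable_limn => n; apply: measurable_funM => //.
rewrite (_ : (fun w => _) = root_count U eps n i).
  by apply: bounded_rv_measurable; exact: (bounded_root_count hS).
by apply/funext => w; rewrite /cluster_size (card_cluster _ (U_range w)).
Qed.

Lemma Zpartial_coord w n j :
  Zpartial p xi U eps w n 0 j = \sum_(1 <= i < n.+1) cluster_lim p U eps i w * x j i w.
Proof. by rewrite /Zpartial summxE; apply: eq_bigr => i _; rewrite mxE. Qed.

Lemma ae_Zpartial_coord : {ae P, forall w, forall n j,
  Zpartial p xi U eps w n 0 j = kap * coord_series p xi U eps j n w}.
Proof.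
apply: filterS ae_cluster_lim => w limw n j.
rewrite Zpartial_coord mulr_sumr !big_nat; apply: eq_bigr => i /andP[i0 _].
by rewrite limw// mulrA.
Qed.

Lemma ae_cvg_Zpartial : {ae P, forall w, cvgn (Zpartial p xi U eps w)}.
Proof.
have cs : {ae P, forall w, forall j, cvgn (coord_series p xi U eps j ^~ w)}.
  by apply: filter_forall => j; exact: (ae_cvg_coord_series halpha hp halphap hS).
apply: filterS2 cs ae_Zpartial_coord => w csw Zw; apply/cvgn_rVP => j.
under eq_fun do rewrite Zw.
by apply: is_cvgMr; exact: csw.
Qed.

Lemma ae_Zlim_coord j : {ae P, forall w,
  Zlim p xi U eps w 0 j = kap * coord_limit p xi U eps j w}.
Proof.
apply: filterS3 (ae_cvg_coord_series halpha hp halphap hS j) ae_Zpartial_coord ae_cvg_Zpartial.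
move=> w csw Zw cZ; rewrite /Zlim limn_coord//; apply/cvg_lim => //.
by under eq_fun do rewrite Zw; apply: cvgMr.
Qed.

Lemma measurable_Zlim_coord j : measurable_fun setT (fun w => Zlim p xi U eps w 0 j).
Proof.
apply: measurable_limn_coord => n i; under eq_fun do rewrite Zpartial_coord.
apply: measurable_sum_nat => k k0; apply: measurable_funM; first exact: measurable_cluster_lim.
exact: (measurable_step hS).
Qed.

Lemma measurable_swim_coord m j : measurable_fun setT (fun w => swim Y m w 0 j).
Proof.
under eq_fun do rewrite swim_coord; apply: measurable_funM => //.
apply: measurable_sum_nat => i i0; apply: measurable_funM; last exact: (measurable_step hS).
by apply: bounded_rv_measurable; exact: (bounded_size_mg hS).
Qed.

Local Notation C := (l1_const alpha p (mg_const alpha p)).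
Local Notation L := (coord_limit p xi U eps).

(** The error splits into the distance of the finite combination to the limiting
    series, and that of the deterministic factor to its limit. *)
Lemma swim_dist t n j : 0 <= t ->
  (\int[P]_w (`|((n%:R `^ p)^-1 *: swim Y (Num.truncn (n%:R * t)) w) 0 j
      - (t `^ p *: Zlim p xi U eps w) 0 j|)%:E <=
   (C * (scaled_growth p t n * mg_rate alpha p (Num.truncn (n%:R * t))
         + `|scaled_growth p t n - t `^ p * kap|))%:E)%E.
Proof.
move=> t0; set m := Num.truncn _; set a := scaled_growth p t n.
have a0 : 0 <= a by rewrite divr_ge0// ?powR_ge0// ltW// growth_gt0.
pose M w := \sum_(1 <= i < m.+1) mg i m w * x j i w.
have mM : measurable_fun setT M.
  apply: measurable_sum_nat => i i0; apply: measurable_funM; last exact: (measurable_step hS).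
  by apply: bounded_rv_measurable; exact: (bounded_size_mg hS).
have mL : measurable_fun setT (L j) by exact: (measurable_coord_limit hS).
pose f1 w := (a%:E * (`|M w - L j w|)%:E)%E.
pose f2 w := (`|a - t `^ p * kap|%:E * (`|L j w|)%:E)%E.
have mML : measurable_fun setT (fun w => (`|M w - L j w|)%:E).
  by apply/measurable_EFinP; apply: measurableT_comp => //; exact: measurable_funB.
have mLE : measurable_fun setT (fun w => (`|L j w|)%:E).
  by apply/measurable_EFinP; exact: measurableT_comp.
apply: (@le_trans _ _ (\int[P]_w (f1 w + f2 w))%E).
  apply: ae_ge0_le_integral => //.
  - apply/measurable_EFinP; apply: measurableT_comp => //; apply: measurable_funB.
      under eq_fun do rewrite mxE; apply: measurable_funM => //; exact: measurable_swim_coord.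
    under eq_fun do rewrite mxE; apply: measurable_funM => //; exact: measurable_Zlim_coord.
  - by move=> w _; rewrite adde_ge0// mule_ge0// lee_fin.
  - by apply: emeasurable_funD; exact: measurable_funeM.
  apply: filterS (ae_Zlim_coord j) => w Zw _; rewrite /f1 /f2 -!EFinM -EFinD lee_fin.
  rewrite !mxE Zw swim_coord -/(M w) -[X in X * `|M w - _|]ger0_norm// -!normrM.
  apply: le_trans (ler_normD _ _); rewrite le_eqVlt; apply/orP; left; apply/eqP.
  by congr (`|_|); rewrite /a /scaled_growth -/m; ring.
rewrite ge0_integralD//; last 4 first.
- by move=> w _; rewrite mule_ge0// lee_fin.
- exact: measurable_funeM.
- by move=> w _; rewrite mule_ge0// lee_fin.
- exact: measurable_funeM.
rewrite !ge0_integralZl_EFin// mulrDr EFinD; apply: leeD.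
  rewrite (mulrCA C) (EFinM a); apply: lee_wpmul2l; first by rewrite lee_fin.
  exact: (coord_limit_dist halpha hp halphap hS).
rewrite (mulrC C) (EFinM `|_|); apply: lee_wpmul2l; first by rewrite lee_fin.
exact: (integral_coord_limit halpha hp halphap hS).
Qed.

End SwimLimit.

Theorem theorem1 (R : realType) (disp : measure_display)
    (T : measurableType disp) (P : probability T R)
    (d : nat) (alpha p t : R)
    (xi : nat -> T -> 'rV[R]_d) (U : nat -> T -> nat)
    (eps : nat -> T -> bool) (Y : nat -> T -> 'rV[R]_d)
    (hd : (1 <= d)%N)
    (halpha : 0 < alpha <= 2) (hp : 0 < p < 1) (halphap : 1 < alpha * p)
    (ht : 0 <= t)
    (hS : shark_random_swim P alpha p xi U eps Y) :
  {ae P, forall w, cvgn (Zpartial p xi U eps w)} /\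
  cvg_in_probability P
    (fun n w => (n%:R `^ p)^-1 *: swim Y (Num.truncn (n%:R * t)) w)
    (fun w => (t `^ p) *: Zlim p xi U eps w).
Proof.
split; first exact: (ae_cvg_Zpartial halpha hp halphap hS).
have grk := is_cvg_growth_ratio hp; set kap := limn _ in grk.
pose m n := Num.truncn (n%:R * t).
apply: (@cvg_in_probability_l1 _ _ _ P d _ _ (fun n => l1_const alpha p (mg_const alpha p) *
  (scaled_growth p t n * mg_rate alpha p (m n) + `|scaled_growth p t n - t `^ p * kap|))).
- move=> n j; under eq_fun do rewrite mxE; apply: measurable_funM => //.
  exact: (measurable_swim_coord hp hS).
- move=> j; under eq_fun do rewrite mxE; apply: measurable_funM => //.
  exact: (measurable_Zlim_coord hS).
- by move=> n j; exact: (swim_dist halpha hp halphap hS).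
rewrite -[X in _ --> X](mulr0 (l1_const alpha p (mg_const alpha p))); apply: cvgMr.
rewrite -[X in _ --> X](addr0 0); apply: cvgD.
  apply: cvg_scaled_growth_rate grk => //.
  by rewrite divr_gt0//; exact: decay_gt0.
rewrite -[X in _ --> X](normr0 R) -(subrr (t `^ p * kap)); apply: cvg_norm.
by apply: cvgB; [exact: cvg_scaled_growth|exact: cvg_cst].
Qed.
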